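(* Let $G$ be a tree-path intersection graph with $n=|G_H|+|G_V|$ vertices, given by its sparse representation $(T_H,T_V,\partial\Gamma)$. Then Algorithm 1 (including the choice of the root edge and of the orders) can be emulated in $\mathcal{O}(n^2)$ time.
   Context: A tree-path intersection graph is a connected bipartite graph $G$ with disjoint parts $G_H$, $G_V$, together with a tree $T_H$ on vertex set $G_H$ and a tree $T_V$ on vertex set $G_V$, such that for every $h\in G_H$ the neighbourhood $\Gamma(h)$ of $h$ in $G$ is the vertex set of a path in $T_V$, and for every $v\in G_V$ the neighbourhood $\Gamma(v)$ is the vertex set of a path in $T_H$. Its sparse representation is $(T_H,T_V,\partial\Gamma)$ where $\partial\Gamma(s)$ is the set of the two endpoints of the path induced by $\Gamma(s)$ in the corresponding tree. Write $hv$ for $\{h,v\}$ ($h\in G_H$, $v\in G_V$). Fix an edge $h_{\mathrm{root}}v_{\mathrm{root}}\in E(G)$ such that $v_{\mathrm{root}}$ is a leaf of $T_V$; root $T_H$ at $h_{\mathrm{root}}$ and $T_V$ at $v_{\mathrm{root}}$. For $s_1,s_2$ both in $G_H$ (resp. both in $G_V$), $s_1\le s_2$ means $s_1$ lies on the path of $T_H$ (resp. $T_V$) from the root to $s_2$; elements of different sides are incomparable; $<$ is the strict version. $\min\Gamma(s)$ denotes the unique $\le$-minimum of $\Gamma(s)$. Define $<_b$: for $s_1,s_2$ on the same side, $s_1<_b s_2$ iff $\min\Gamma(s_1)<\min\Gamma(s_2)$, or $\min\Gamma(s_1)=\min\Gamma(s_2)$ and $s_1<s_2$. Let $<_\ell$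 be a relation that restricted to $G_H$ and to $G_V$ is a linear order extending $<_b$; $\le_\ell$ is its reflexive version. A semi-guard is an ordered pair $(h,v)\in G_H\times G_V$ with $\min\Gamma(v)\min\Gamma(h)\in E(G)$; it covers $h'v'\in E(G)$ iff $h'\le_\ell h$, $v'\le_\ell v$, $\min\Gamma(h)\in\Gamma(h')$ and $\min\Gamma(v)\in\Gamma(v')$. A set of semi-guards covers an edge if some member covers it. Algorithm 1: let $k=|G_V|$ and $s_1,\dots,s_k$ the elements of $G_V$ with $s_k<_\ell\cdots<_\ell s_1$; $W_0=\emptyset$. For $i=1,\dots,k$: let $t_i$ be the $<_\ell$-maximum of $\{t\in\Gamma(s_i): ts_i\text{ not covered by }W_{i-1}\}$ ($t_i=\emptyset$ if empty). If $t_i\ne\emptyset$: if some $(h,v)\in W_{i-1}$ has $h\in\Gamma(s_i)$, choose such with $h$ $<_\ell$-maximal and set $W_i=(W_{i-1}\setminus\{(h,v)\})\cup\{(t_i,v)\}$; else $W_i=W_{i-1}\cup\{(t_i,s_i)\}$. If $t_i=\emptyset$, $W_i=W_{i-1}$. *)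

(* Defs.v *)
From mathcomp Require Import all_boot.

Set Implicit Arguments.
Unset Strict Implicit.
Unset Printing Implicit Defensive.

(** * Tree-path intersection graphs *)

Definition simple_graph (T : finType) (e : rel T) : Prop :=
  symmetric e /\ irreflexive e.

Definition connected (T : finType) (e : rel T) : Prop :=
  forall x y : T, connect e x y.

(* In a simple graph, [ucycle e [:: x; y]] just says that xy is an edge. *)
Definition acyclic (T : finType) (e : rel T) : Prop :=
  forall c : seq T, ucycle e c -> size c <= 2.

Definition is_tree (T : finType) (e : rel T) : Prop :=
  [/\ 0 < #|T|, simple_graph e, connected e & acyclic e].

(* x = y is allowed: a one-vertex path has both its endpoints equal. *)
Definition path_with_ends (T : finType) (e : rel T) (x y : T) (S : {set T}) :
    Prop :=
  exists p : seq T,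
    [/\ path e x p, uniq (x :: p), last x p = y & S =i x :: p].

Definition bip_adj (H V : finType) (E : H -> V -> bool) : rel (H + V) :=
  fun s t => match s, t with
             | inl h, inr v | inr v, inl h => E h v
             | _, _ => false
             end.

Record tpig (H V : finType) := Tpig {
  edge : H -> V -> bool;
  treeH : rel H;
  treeV : rel V;
  tpig_connected : connected (bip_adj edge);
  treeHP : is_tree treeH;
  treeVP : is_tree treeV;
  nbrHP : forall h, exists x y, path_with_ends treeV x y [set v | edge h v];
  nbrVP : forall v, exists x y, path_with_ends treeH x y [set h | edge h v]
}.

Definition nbrH (H V : finType) (G : tpig H V) (h : H) : {set V} :=
  [set v | edge G h v].

Definition nbrV (H V : finType) (G : tpig H V) (v : V) : {set H} :=
  [set h | edge G h v].

(** * Rooted trees and orders *)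

Definition tree_le (T : finType) (e : rel T) (r x y : T) : Prop :=
  exists p : seq T,
    [/\ path e r p, uniq (r :: p), last r p = y & x \in r :: p].

Definition tree_lt (T : finType) (e : rel T) (r x y : T) : Prop :=
  x <> y /\ tree_le e r x y.

Definition tree_min (T : finType) (e : rel T) (r : T) (S : {set T}) (m : T) :
    Prop :=
  m \in S /\ forall x, x \in S -> tree_le e r m x.

(* A one-vertex tree has its vertex as a leaf, so that a root edge always
   exists. *)
Definition leaf (T : finType) (e : rel T) (x : T) : Prop :=
  #|[set y | e x y]| <= 1.

(* A strict linear order, given by its graph. *)
Definition linear_order (T : finType) (l : rel T) : Prop :=
  [/\ irreflexive l, transitive l & forall x y, x != y -> l x y || l y x].

Record choices (H V : finType) := Choices {
  rootH : H;
  rootV : V;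
  ltlH : rel H;
  ltlV : rel V
}.

Definition lelH (H V : finType) (c : choices H V) (x y : H) : bool :=
  (x == y) || ltlH c x y.

Definition lelV (H V : finType) (c : choices H V) (x y : V) : bool :=
  (x == y) || ltlV c x y.

(* [min_nbrH G c h m] : m is min Gamma(h); likewise for [min_nbrV]. *)
Definition min_nbrH (H V : finType) (G : tpig H V) (c : choices H V)
    (h : H) (m : V) : Prop :=
  tree_min (treeV G) (rootV c) (nbrH G h) m.

Definition min_nbrV (H V : finType) (G : tpig H V) (c : choices H V)
    (v : V) (m : H) : Prop :=
  tree_min (treeH G) (rootH c) (nbrV G v) m.

Definition ltbH (H V : finType) (G : tpig H V) (c : choices H V)
    (s1 s2 : H) : Prop :=
  exists m1 m2 : V, [/\ min_nbrH G c s1 m1, min_nbrH G c s2 m2 &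
    tree_lt (treeV G) (rootV c) m1 m2 \/
    (m1 = m2 /\ tree_lt (treeH G) (rootH c) s1 s2)].

Definition ltbV (H V : finType) (G : tpig H V) (c : choices H V)
    (s1 s2 : V) : Prop :=
  exists m1 m2 : H, [/\ min_nbrV G c s1 m1, min_nbrV G c s2 m2 &
    tree_lt (treeH G) (rootH c) m1 m2 \/
    (m1 = m2 /\ tree_lt (treeV G) (rootV c) s1 s2)].

Definition valid_choices (H V : finType) (G : tpig H V) (c : choices H V) :
    Prop :=
  [/\ edge G (rootH c) (rootV c) /\ leaf (treeV G) (rootV c),
      linear_order (ltlH c), linear_order (ltlV c),
      forall x y, ltbH G c x y -> ltlH c x y &
      forall x y, ltbV G c x y -> ltlV c x y].

(** * Semi-guards and the algorithm *)

Definition semi_guard (H V : finType) (G : tpig H V) (c : choices H V)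
    (g : H * V) : Prop :=
  exists (mh : V) (mv : H),
    [/\ min_nbrH G c g.1 mh, min_nbrV G c g.2 mv & edge G mv mh].

Definition covers (H V : finType) (G : tpig H V) (c : choices H V)
    (g : H * V) (h' : H) (v' : V) : Prop :=
  semi_guard G c g /\ edge G h' v' /\
  exists (mh : V) (mv : H),
    [/\ min_nbrH G c g.1 mh, min_nbrV G c g.2 mv,
        lelH c h' g.1 /\ lelV c v' g.2, mh \in nbrH G h' & mv \in nbrV G v'].

Definition set_covers (H V : finType) (G : tpig H V) (c : choices H V)
    (W : {set H * V}) (h' : H) (v' : V) : Prop :=
  exists2 g, g \in W & covers G c g h' v'.

(* t is the <_l-maximum of the elements of Gamma(s) whose edge to s is not
   covered by W. *)
Definition max_uncovered (H V : finType) (G : tpig H V) (c : choices H V)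
    (W : {set H * V}) (s : V) (t : H) : Prop :=
  [/\ t \in nbrV G s, ~ set_covers G c W t s &
      forall t', t' \in nbrV G s -> ~ set_covers G c W t' s -> lelH c t' t].

(* One iteration of the loop: [step G c s W t W'] with s = s_i, W = W_{i-1},
   t = t_i and W' = W_i. *)
Inductive step (H V : finType) (G : tpig H V) (c : choices H V) (s : V)
    (W : {set H * V}) : option H -> {set H * V} -> Prop :=
| StepNone :
    (forall t, t \in nbrV G s -> set_covers G c W t s) ->
    step G c s W None W
| StepReplace t h v :
    max_uncovered G c W s t ->
    (h, v) \in W -> h \in nbrV G s ->
    (forall h' v', (h', v') \in W -> h' \in nbrV G s -> lelH c h' h) ->
    step G c s W (Some t) ((t, v) |: (W :\ (h, v)))
| StepAdd t :
    max_uncovered G c W s t ->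
    (forall h v, (h, v) \in W -> h \notin nbrV G s) ->
    step G c s W (Some t) ((t, s) |: W).

Inductive steps (H V : finType) (G : tpig H V) (c : choices H V) :
    seq V -> {set H * V} -> seq (option H) -> {set H * V} -> Prop :=
| StepsNil W : steps G c [::] W [::] W
| StepsCons s ss W t W1 ts W2 :
    step G c s W t W1 -> steps G c ss W1 ts W2 ->
    steps G c (s :: ss) W (t :: ts) W2.

Definition decreasing_list (T : finType) (l : rel T) (s : seq T) : Prop :=
  perm_eq s (enum T) /\ sorted (fun x y => l y x) s.

(* A complete run: sV = [:: s_1; ...; s_k], ts = [:: t_1; ...; t_k] and
   W = W_k. *)
Definition run (H V : finType) (G : tpig H V) (c : choices H V)
    (sV : seq V) (ts : seq (option H)) (W : {set H * V}) : Prop :=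
  [/\ valid_choices G c, decreasing_list (ltlV c) sV &
      steps G c sV set0 ts W].

(** * Word RAM *)

(* A random access machine with structured control flow. Its memory consists of
   registers and of arrays; the names of the registers and arrays occurring in
   a program are constants, so a program uses boundedly many of each. Every
   elementary operation has unit cost. All computed values must be smaller than
   the bound B, otherwise the machine is stuck; taking B polynomial in the
   size of the input gives words of logarithmically many bits. *)

Inductive expr :=
| Cst of nat
| Reg of nat
| Get of nat & expr
| Add of expr & expr
| Sub of expr & expr
| Mul of expr & expr
| Eq of expr & expr
| Lt of expr & expr.

Inductive cmd :=
| Skip
| SetReg of nat & expr
| Put of nat & expr & expr
| Seq of cmd & cmd
| If of expr & cmd & cmd
| While of expr & cmd.

Record state := State {
  reg : nat -> nat;
  arr : nat -> nat -> nat
}.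

Definition set_reg (s : state) (r x : nat) : state :=
  State (fun r' => if r' == r then x else reg s r') (arr s).

Definition set_arr (s : state) (a i x : nat) : state :=
  State (reg s)
    (fun a' i' => if (a' == a) && (i' == i) then x else arr s a' i').

Definition word (B x : nat) : option nat := if x < B then Some x else None.

Fixpoint eval (B : nat) (s : state) (e : expr) : option nat :=
  let op2 f e1 e2 :=
    if (eval B s e1, eval B s e2) is (Some x, Some y) then word B (f x y)
    else None in
  match e with
  | Cst x => word B x
  | Reg r => word B (reg s r)
  | Get a e1 => if eval B s e1 is Some i then word B (arr s a i) else None
  | Add e1 e2 => op2 addn e1 e2
  | Sub e1 e2 => op2 subn e1 e2
  | Mul e1 e2 => op2 muln e1 e2
  | Eq e1 e2 => op2 (fun x y => nat_of_bool (x == y)) e1 e2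
  | Lt e1 e2 => op2 (fun x y => nat_of_bool (x < y)) e1 e2
  end.

Fixpoint cost (e : expr) : nat :=
  match e with
  | Cst _ | Reg _ => 1
  | Get _ e1 => (cost e1).+1
  | Add e1 e2 | Sub e1 e2 | Mul e1 e2 | Eq e1 e2 | Lt e1 e2 =>
      (cost e1 + cost e2).+1
  end.

(* [exec B p s t s'] : started in state s, p halts after t units of time in
   state s'. *)
Inductive exec (B : nat) : cmd -> state -> nat -> state -> Prop :=
| ExSkip s : exec B Skip s 1 s
| ExSetReg r e x s :
    eval B s e = Some x ->
    exec B (SetReg r e) s (cost e).+1 (set_reg s r x)
| ExPut a e1 e2 i x s :
    eval B s e1 = Some i -> eval B s e2 = Some x ->
    exec B (Put a e1 e2) s (cost e1 + cost e2).+1 (set_arr s a i x)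
| ExSeq p1 p2 s s1 s2 t1 t2 :
    exec B p1 s t1 s1 -> exec B p2 s1 t2 s2 ->
    exec B (Seq p1 p2) s (t1 + t2) s2
| ExIfTrue e p1 p2 x s s1 t :
    eval B s e = Some x -> x != 0 -> exec B p1 s t s1 ->
    exec B (If e p1 p2) s ((cost e).+1 + t) s1
| ExIfFalse e p1 p2 s s1 t :
    eval B s e = Some 0 -> exec B p2 s t s1 ->
    exec B (If e p1 p2) s ((cost e).+1 + t) s1
| ExWhileTrue e p x s s1 s2 t1 t2 :
    eval B s e = Some x -> x != 0 ->
    exec B p s t1 s1 -> exec B (While e p) s1 t2 s2 ->
    exec B (While e p) s ((cost e).+1 + t1 + t2) s2
| ExWhileFalse e p s :
    eval B s e = Some 0 ->
    exec B (While e p) s (cost e).+1 s.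

(** * Input and output *)

(* The edges of a tree on a vertices, in any order and orientation, fill a list
   of length a - 1 exactly once each. *)
Record sparse_rep (a b : nat) := SparseRep {
  edgesH : (a.-1).-tuple ('I_a * 'I_a);
  edgesV : (b.-1).-tuple ('I_b * 'I_b);
  endsH : 'I_a -> 'I_b * 'I_b;
  endsV : 'I_b -> 'I_a * 'I_a
}.

Definition lists_edges (T : finType) (e : rel T) (l : seq (T * T)) : Prop :=
  forall x y, e x y = ((x, y) \in l) || ((y, x) \in l).

Definition represents (a b : nat) (R : sparse_rep a b)
    (G : tpig 'I_a 'I_b) : Prop :=
  [/\ lists_edges (treeH G) (edgesH R), lists_edges (treeV G) (edgesV R),
      forall h, path_with_ends (treeV G) (endsH R h).1 (endsH R h).2 (nbrH G h) &
      forall v, path_with_ends (treeH G) (endsV R v).1 (endsV R v).2 (nbrV G v)].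

Definition input_arrays (a b : nat) (R : sparse_rep a b) : seq (seq nat) :=
  [:: [seq val p.1 | p <- edgesH R]; [seq val p.2 | p <- edgesH R];
      [seq val p.1 | p <- edgesV R]; [seq val p.2 | p <- edgesV R];
      [seq val (endsH R h).1 | h <- enum 'I_a];
      [seq val (endsH R h).2 | h <- enum 'I_a];
      [seq val (endsV R v).1 | v <- enum 'I_b];
      [seq val (endsV R v).2 | v <- enum 'I_b]].

(* Cells not used by the input hold 0. *)
Definition input_state (a b : nat) (R : sparse_rep a b) : state :=
  State (nth 0 [:: a; b])
        (fun j i => nth 0 (nth [::] (input_arrays R) j) i).

Definition holds_seq (s : state) (j : nat) (l : seq nat) : Prop :=
  forall i, i < size l -> arr s j i = nth 0 l i.

Definition code_opt (a : nat) (t : option 'I_a) : nat :=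
  if t is Some x then (val x).+1 else 0.

(* The final state displays the root edge, both orders <_l as decreasing lists,
   t_1, ..., t_k and an enumeration of W_k, all belonging to one and the same
   run of the algorithm. *)
Definition output_run (a b : nat) (G : tpig 'I_a 'I_b) (s : state) : Prop :=
  exists (c : choices 'I_a 'I_b) (sH : seq 'I_a) (sV : seq 'I_b)
         (ts : seq (option 'I_a)) (W : seq ('I_a * 'I_b)),
    [/\ run G c sV ts [set g in W] /\ uniq W,
        decreasing_list (ltlH c) sH,
        [/\ reg s 0 = rootH c, reg s 1 = rootV c & reg s 2 = size W],
        [/\ holds_seq s 8 (map val sH), holds_seq s 9 (map val sV) &
            holds_seq s 10 (map (@code_opt a) ts)] &
        holds_seq s 11 [seq val g.1 | g <- W] /\
        holds_seq s 12 [seq val g.2 | g <- W]].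

(* Main.v *)
Require Import Defs.
From mathcomp Require Import all_boot.
From mathcomp Require Import zify.

(* Root T_V first at vertex 0: the vertex reached last is a leaf, which becomes
   v_root, and any endpoint of Gamma(v_root) becomes h_root. With both trees
   rooted, tables of ancestors give min Gamma(s) as the last common ancestor of
   the two ends of Gamma(s), and a constant-time test for adjacency; sorting by
   (position of min Gamma(s), position of s) yields a linear extension of <_b.

   What remains is to find t_i in linear time. An element (h, v) of W_(i-1)
   covers t s_i iff it is a semi-guard with min Gamma(v) in Gamma(s_i),
   t <=_l h and min Gamma(h) in Gamma(t). Let p, q be the ends of Gamma(t).
   Once t <=_l h, the last condition just says that min Gamma(h) is an ancestor
   of p or of q: if min Gamma(h) were strictly above min Gamma(t), then h <_b t.
   So store at every vertex of T_V the largest rank of a relevant h with this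
   minimum, push maxima down the tree, and t is covered iff the value at p or
   at q is at least the rank of t.

   The programs only have counting loops with bounds |G_H| and |G_V|,
   so their running time can be read off from the syntax. They only ever store
   copies and increments of values, so the elapsed time also bounds all words. *)

Set Implicit Arguments.
Unset Strict Implicit.
Unset Printing Implicit Defensive.

(** * Programs with counting loops *)

(** The covering test can omit the condition $v'\le_\ell v$. The $s_i$ are treated in decreasing
    order and a replacement keeps the second component of a pair, so the second components of
    $W_{i-1}$ are distinct, already treated vertices, all above $s_i$. The same fact gives $|W_i|\le
    |G_V|$, which is what allows a counting loop bounded by $|G_V|$ to scan the whole set. Tree
    edges arrive in arbitrary order, so a tree is rooted by sweeping the edge list once per vertex;
    quadratic time pays for this. The resulting order of visits puts parents before children and
    replaces recursion: ancestor tables, common ancestors and the downward pushing of maxima are all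
    loops along it. Comparisons use ranks instead of lexicographic keys. A key is a product, and
    storing products would destroy the linear growth of memory cells in time; a rank is obtained by
    counting. Ranks, positions and vertex codes are shifted by one so that 0 can mean absence. *)

Inductive prg :=
| PSkip
| PSet of nat & expr
| PPut of nat & expr & expr
| PSeq of prg & prg
| PIf of expr & prg & prg
| PFor of nat & nat & prg.

Fixpoint compile (p : prg) : cmd :=
  match p with
  | PSkip => Skip
  | PSet r e => SetReg r e
  | PPut a e1 e2 => Put a e1 e2
  | PSeq p q => Seq (compile p) (compile q)
  | PIf e p q => If e (compile p) (compile q)
  | PFor r nb p =>
      Seq (SetReg r (Cst 0))
          (While (Lt (Reg r) (Reg nb))
                 (Seq (compile p) (SetReg r (Add (Reg r) (Cst 1)))))
  end.

Fixpoint value (s : state) (e : expr) : nat :=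
  match e with
  | Cst x => x
  | Reg r => reg s r
  | Get a e1 => arr s a (value s e1)
  | Add e1 e2 => value s e1 + value s e2
  | Defs.Sub e1 e2 => value s e1 - value s e2
  | Mul e1 e2 => value s e1 * value s e2
  | Eq e1 e2 => value s e1 == value s e2
  | Lt e1 e2 => value s e1 < value s e2
  end.

(** A loop reads its bound once and overwrites its counter by [i.+1]. The compiled loop rereads the
    bound and increments the counter; both agree on admissible programs, whose bodies write
    neither. *)
Fixpoint den (p : prg) (s : state) : state :=
  match p with
  | PSkip => s
  | PSet r e => set_reg s r (value s e)
  | PPut a e1 e2 => set_arr s a (value s e1) (value s e2)
  | PSeq p q => den q (den p s)
  | PIf e p q => if value s e != 0 then den p s else den q s
  | PFor r nb p =>
      foldl (fun st i => set_reg (den p st) r i.+1) (set_reg s r 0)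
            (iota 0 (reg s nb))
  end.

Fixpoint written_regs (p : prg) : seq nat :=
  match p with
  | PSet r _ => [:: r]
  | PSeq p q | PIf _ p q => written_regs p ++ written_regs q
  | PFor r _ p => r :: written_regs p
  | _ => [::]
  end.

Fixpoint written_arrs (p : prg) : seq nat :=
  match p with
  | PPut a _ _ => [:: a]
  | PSeq p q | PIf _ p q => written_arrs p ++ written_arrs q
  | PFor _ _ p => written_arrs p
  | _ => [::]
  end.

Lemma den_reg p s r : r \notin written_regs p -> reg (den p s) r = reg s r.
Proof.
elim: p s => [|r' e|a e1 e2|p IHp q IHq|e p IHp q IHq|r' nb p IHp] s //=.
- by rewrite inE => /negbTE ->.
- by rewrite mem_cat negb_or => /andP[? ?]; rewrite IHq // IHp.
- by rewrite mem_cat negb_or => /andP[? ?]; case: ifP => _; rewrite ?IHq ?IHp.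
- rewrite inE negb_or => /andP[/negbTE rr' rp].
  set f := fun _ _ => _.
  suff H l st : reg (foldl f st l) r = reg st r by rewrite H /= rr'.
  by elim: l st => //= i l IH st; rewrite IH /= rr' IHp.
Qed.

Lemma den_arr p s a i : a \notin written_arrs p -> arr (den p s) a i = arr s a i.
Proof.
elim: p s => [|r' e|a' e1 e2|p IHp q IHq|e p IHp q IHq|r' nb p IHp] s //=.
- by rewrite inE => /negbTE ->.
- by rewrite mem_cat negb_or => /andP[? ?]; rewrite IHq // IHp.
- by rewrite mem_cat negb_or => /andP[? ?]; case: ifP => _; rewrite ?IHq ?IHp.
- move=> ap; set f := fun _ _ => _.
  suff H l st : arr (foldl f st l) a i = arr st a i by rewrite H.
  by elim: l st => //= k l IH st; rewrite IH /= IHp.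
Qed.

(** Besides the invariant, each iteration may assume that all registers and arrays outside the
    written ones still agree with the initial state, so invariants need not carry such frame
    facts. *)
Lemma den_for_ind r nb p s (I : nat -> state -> Prop) :
  I 0 (set_reg s r 0) ->
  (forall i st, i < reg s nb -> reg st r = i ->
     (forall r', r' \notin r :: written_regs p -> reg st r' = reg s r') ->
     (forall a k, a \notin written_arrs p -> arr st a k = arr s a k) ->
     I i st -> I i.+1 (set_reg (den p st) r i.+1)) ->
  I (reg s nb) (den (PFor r nb p) s).
Proof.
move=> I0 IS /=; set f := fun _ _ => _.
suff H k i st : i + k = reg s nb -> reg st r = i ->
     (forall r', r' \notin r :: written_regs p -> reg st r' = reg s r') ->
     (forall a k, a \notin written_arrs p -> arr st a k = arr s a k) ->
     I i st -> I (i + k) (foldl f st (iota i k)).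
  apply: (H (reg s nb) 0) => //=; first by rewrite eqxx.
  by move=> r'; rewrite inE negb_or => /andP[/negbTE -> _].
elim: k i st => [|k IH] i st; first by rewrite addn0.
move=> eik er fr fa Ii /=; rewrite -addSnnS; apply: IH.
- by rewrite addSnnS.
- by rewrite /= eqxx.
- move=> r' r'P; move: (r'P); rewrite inE negb_or => /andP[/negbTE rr' r'p].
  by rewrite /= rr' den_reg // fr.
- by move=> a j ap; rewrite /= den_arr // fa.
- by apply: IS => //; rewrite -eik; lia.
Qed.

(** * Execution time and word size *)

Fixpoint unit_csts (e : expr) : bool :=
  match e with
  | Cst x => x <= 1
  | Reg _ => true
  | Get _ e1 => unit_csts e1
  | Add e1 e2 | Defs.Sub e1 e2 | Mul e1 e2 | Eq e1 e2 | Lt e1 e2 =>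
      unit_csts e1 && unit_csts e2
  end.

(** Expressions whose value exceeds the largest memory cell by at most their cost. Only these are
    stored, so cells grow at most linearly with time, while products remain available in tests and
    addresses. *)
Fixpoint small (e : expr) : bool :=
  match e with
  | Cst _ | Reg _ | Get _ _ => true
  | Add e1 (Cst _) | Defs.Sub e1 _ => small e1
  | _ => false
  end.

Definition cells_le (s : state) (m : nat) : Prop :=
  (forall r, reg s r <= m) /\ (forall a i, arr s a i <= m).

Lemma cells_leW s m m' : m <= m' -> cells_le s m -> cells_le s m'.
Proof.
by move=> mm' [cr ca]; split=> *; apply: leq_trans mm'; [apply: cr|apply: ca].
Qed.

Lemma cells_le_set_reg s r x m :
  x <= m -> cells_le s m -> cells_le (set_reg s r x) m.
Proof. by move=> xm [cr ca]; split=> //= r'; case: ifP. Qed.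

Lemma cells_le_set_arr s a i x m :
  x <= m -> cells_le s m -> cells_le (set_arr s a i x) m.
Proof. by move=> xm [cr ca]; split=> //= a' i'; case: ifP. Qed.

(** Each operator raises the cost by one, that is, the bound by a factor [m + 2]. This factor
    absorbs a sum, since $x+y\le 2xy$ for positive $x,y$, and a product of two powers is a power
    with the summed exponent. *)
Lemma value_le s m e :
  cells_le s m -> unit_csts e -> value s e <= (m + 2) ^ cost e.
Proof.
move=> [cr ca].
have X k : 0 < (m + 2) ^ k by rewrite expn_gt0 addn2.
have P1 k : m <= (m + 2) ^ k.+1.
  by rewrite expnS; apply: leq_trans (leq_pmulr _ (X k)); rewrite leq_addr.
have S1 k l : (m + 2) ^ k + (m + 2) ^ l <= (m + 2) ^ (k + l).+1.
  rewrite expnS expnD; move: (X k) (X l).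
  move: ((m+2)^k) ((m+2)^l) => x y x0 y0.
  have: x <= x * y by rewrite leq_pmulr.
  have: y <= x * y by rewrite leq_pmull.
  nia.
have M1 k l x : x <= (m + 2) ^ (k + l) -> x <= (m + 2) ^ (k + l).+1.
  by move=> xl; apply: leq_trans xl _; rewrite leq_exp2l // addn2.
elim: e => [x|r|a e IH|e1 IH1 e2 IH2|e1 IH1 e2 IH2|e1 IH1 e2 IH2|e1 IH1 e2 IH2
  |e1 IH1 e2 IH2] /=.
- by move=> x1; apply: leq_trans x1 _; rewrite expn1 addn2.
- by move=> _; apply: leq_trans (cr _) (P1 0).
- by move=> _; apply: leq_trans (ca _ _) (P1 _).
- by case/andP=> /IH1 h1 /IH2 h2; apply: leq_trans (leq_add h1 h2) (S1 _ _).
- case/andP=> /IH1 h1 _; apply: leq_trans (leq_subr _ _) _.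
  by apply: M1; rewrite expnD; apply: leq_trans h1 _; rewrite leq_pmulr.
- by case/andP=> /IH1 h1 /IH2 h2; apply: M1; rewrite expnD leq_mul.
- by move=> _; apply: leq_trans (leq_b1 _) (X _).
- by move=> _; apply: leq_trans (leq_b1 _) (X _).
Qed.

Lemma eval_value B s m e : cells_le s m -> unit_csts e ->
  (m + 2) ^ cost e < B -> eval B s e = Some (value s e).
Proof.
move=> c.
have W e' : unit_csts e' -> (m + 2) ^ cost e' < B ->
    word B (value s e') = Some (value s e').
  by move=> u h; rewrite /word (leq_ltn_trans (value_le c u) h).
have L k l : (m + 2) ^ (k + l).+1 < B -> (m + 2) ^ k < B /\ (m + 2) ^ l < B.
  by move=> h; split; apply: leq_ltn_trans h; rewrite leq_exp2l ?addn2 //; lia.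
have D e1 e2 f : (unit_csts e1 -> (m + 2) ^ cost e1 < B ->
      eval B s e1 = Some (value s e1)) ->
    (unit_csts e2 -> (m + 2) ^ cost e2 < B -> eval B s e2 = Some (value s e2)) ->
    unit_csts e1 && unit_csts e2 -> (m + 2) ^ (cost e1 + cost e2).+1 < B ->
    (if (eval B s e1, eval B s e2) is (Some x, Some y) then word B (f x y)
      else None) = word B (f (value s e1) (value s e2)).
  by move=> I1 I2 /andP[u1 u2] /L[h1 h2]; rewrite I1 // I2.
elim: e => [x|r|a e IH|e1 IH1 e2 IH2|e1 IH1 e2 IH2|e1 IH1 e2 IH2|e1 IH1 e2 IH2
  |e1 IH1 e2 IH2] u h; try by rewrite -W //= D.
rewrite /= IH //; first exact: (W (Get a e)).
by apply: leq_ltn_trans h; rewrite leq_exp2l //= addn2.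
Qed.

Lemma small_le s m e : 0 < m -> cells_le s m -> unit_csts e -> small e ->
  value s e <= m + cost e.
Proof.
move=> m0 [cr ca]; elim: e => //=.
- by move=> x; lia.
- by move=> r _ _; rewrite (leq_trans (cr r)) ?leq_addr.
- by move=> a e _ _ _; rewrite (leq_trans (ca _ _)) ?leq_addr.
- move=> e1 IH1 [] //= x _ /andP[u x1] se; have := IH1 u se; lia.
- move=> e1 IH1 e2 _ /andP[u _] se; have := IH1 u se; lia.
Qed.

(* Registers 3 and 4 hold the loop bounds |G_H| and |G_V|. *)
Fixpoint admissible (p : prg) : bool :=
  match p with
  | PSkip => true
  | PSet r e => [&& unit_csts e, small e & r \notin [:: 3; 4]]
  | PPut a e1 e2 => [&& unit_csts e1, unit_csts e2 & small e2]
  | PSeq p q => admissible p && admissible q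
  | PIf e p q => [&& unit_csts e, admissible p & admissible q]
  | PFor r nb p =>
      [&& nb \in [:: 3; 4], r \notin [:: 3; 4], r \notin written_regs p & admissible p]
  end.

(** For a loop, 2 is the initialisation of the counter, 8 the test and the increment of one round at
    cost 4 each, and the last 4 the failing test. Both branches of a conditional are added, which
    costs only a constant factor. *)
Fixpoint time (p : prg) (N : nat) : nat :=
  match p with
  | PSkip => 1
  | PSet _ e => (cost e).+1
  | PPut _ e1 e2 => (cost e1 + cost e2).+1
  | PSeq p q => time p N + time q N
  | PIf e p q => (cost e).+1 + (time p N + time q N)
  | PFor _ _ p => 2 + (N * (time p N + 8) + 4)
  end.

Fixpoint max_cost (p : prg) : nat :=
  match p with
  | PSkip => 1
  | PSet _ e => cost e
  | PPut _ e1 e2 => cost e1 + cost e2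
  | PSeq p q => max_cost p + max_cost q
  | PIf e p q => cost e + (max_cost p + max_cost q)
  | PFor _ _ p => 3 + max_cost p
  end.

Lemma admissible_written_regs p r : admissible p -> r \in [:: 3; 4] -> r \notin written_regs p.
Proof.
move=> + r34; elim: p => //=.
- move=> r' e /and3P[_ _ h]; rewrite inE.
  by apply: contra h => /eqP <-.
- by move=> p IHp q IHq /andP[/IHp ? /IHq ?]; rewrite mem_cat negb_or; apply/andP.
- by move=> e p IHp q IHq /and3P[_ /IHp ? /IHq ?]; rewrite mem_cat negb_or; apply/andP.
- move=> r' nb p IHp /and4P[_ h _ /IHp ?]; rewrite inE negb_or; apply/andP.
  by split=> //; apply: contra h => /eqP <-.
Qed.

(** Cells bounded by [m] at the start are bounded by [m + t] after time [t], because an assignment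
    takes longer than the growth it causes. Hence every value met is at most
    [(m + time p N + 2) ^ max_cost p], and the machine never gets stuck. *)
Lemma exec_den B N p s m :
  admissible p -> reg s 3 <= N -> reg s 4 <= N -> 0 < m -> cells_le s m ->
  (m + time p N + 2) ^ max_cost p < B ->
  exists2 t, exec B (compile p) s t (den p s) &
    t <= time p N /\ cells_le (den p s) (m + t).
Proof.
have leB x y x' y' : x' <= x -> y' <= y ->
    (x + 2) ^ y < B -> (x' + 2) ^ y' < B.
  move=> hx hy; apply: leq_ltn_trans.
  apply: (@leq_trans ((x' + 2) ^ y)); first by rewrite leq_exp2l ?addn2.
  by case: y {hy} => // y; rewrite leq_exp2r // leq_add2r.
elim: p s m => [|r e|a e1 e2|p IHp q IHq|e p IHp q IHq|r nb p IHp] s m /=.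
- move=> _ _ _ _ c _; exists 1; first exact: ExSkip.
  by split=> //; apply: cells_leW c; rewrite leq_addr.
- case/and3P=> u sm _ _ _ m0 c hB; exists (cost e).+1.
    by apply: ExSetReg; apply: (eval_value c u); apply: leB hB; lia.
  split=> //; apply: cells_le_set_reg; last by apply: cells_leW c; rewrite leq_addr.
  by apply: leq_trans (small_le m0 c u sm) _; rewrite leq_add2l.
- case/and3P=> u1 u2 sm _ _ m0 c hB; exists (cost e1 + cost e2).+1.
    by apply: ExPut; apply: (eval_value c) => //; apply: leB hB; lia.
  split=> //; apply: cells_le_set_arr; last by apply: cells_leW c; rewrite leq_addr.
  by apply: leq_trans (small_le m0 c u2 sm) _; lia.
- case/andP=> ap aq s3 s4 m0 c hB.
  have [|t1 e1 [l1 c1]] := IHp s m ap s3 s4 m0 c.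
    by apply: leB hB; lia.
  have [||||t2 e2 [l2 c2]] := IHq (den p s) (m + t1) aq _ _ _ c1.
  + by rewrite den_reg // (admissible_written_regs ap).
  + by rewrite den_reg // (admissible_written_regs ap).
  + by lia.
  + by apply: leB hB; lia.
  exists (t1 + t2); first exact: ExSeq e1 e2.
  by split; [apply: leq_add|rewrite addnA].
- case/and3P=> u ap aq s3 s4 m0 c hB.
  have ev : eval B s e = Some (value s e).
    by apply: (eval_value c u); apply: leB hB; lia.
  case: ifPn => [v0|/negPn /eqP v0].
  + have [|t1 e1 [l1 c1]] := IHp s m ap s3 s4 m0 c; first by apply: leB hB; lia.
    exists ((cost e).+1 + t1); first exact: ExIfTrue ev v0 e1.
    by split; [lia|apply: cells_leW c1; lia].
  + have [|t1 e1 [l1 c1]] := IHq s m aq s3 s4 m0 c; first by apply: leB hB; lia.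
    exists ((cost e).+1 + t1); first by apply: ExIfFalse e1; rewrite ev v0.
    by split; [lia|apply: cells_leW c1; lia].
- case/and4P=> nb34 r34 rp ap s3 s4 m0 c hB.
  have nbr : (nb == r) = false by apply/negP => /eqP er; rewrite -er nb34 in r34.
  have nbN : reg s nb <= N by move: nb34; rewrite !inE => /orP[]/eqP ->.
  have nbp : nb \notin written_regs p by apply: admissible_written_regs.
  set w := While _ _; pose f := fun st i => set_reg (den p st) r i.+1.
  set x := reg s nb; rewrite -/f.
  suff H k : forall i st m', i + k = x -> reg st r = i -> reg st nb = x ->
      reg st 3 <= N -> reg st 4 <= N ->
      0 < m' -> cells_le st m' ->
      (m' + (k * (time p N + 8) + 4) + 2) ^ (3 + max_cost p) < B ->
      exists2 t, exec B w st t (foldl f st (iota i k)) &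
        t <= k * (time p N + 8) + 4 /\ cells_le (foldl f st (iota i k)) (m' + t).
    have xN : x * (time p N + 8) <= N * (time p N + 8) by rewrite leq_mul2r nbN orbT.
    have [||||||||t e [l cc]] := H x 0 (set_reg s r 0) m.
    + by [].
    + by rewrite /= eqxx.
    + by rewrite /= nbr.
    + by move: r34; rewrite /= !inE !negb_or eq_sym => /andP[/negbTE -> _].
    + by move: r34; rewrite /= !inE !negb_or [r == 4]eq_sym => /andP[_ /negbTE ->].
    + by [].
    + exact: cells_le_set_reg.
    + by apply: leB hB; lia.
    exists (2 + t).
      apply: ExSeq e; apply: (@ExSetReg _ r (Cst 0)) => //=.
      rewrite /word; case: B hB {IHp leB H} => //.
    by split; [lia|apply: cells_leW cc; lia].
  elim: k => [|k IH] i st m' eik er enb st3 st4 m'0 c' hB'.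
    rewrite addn0 in eik; exists 4.
      apply: ExWhileFalse.
      rewrite (eval_value c') //=; first by rewrite er enb eik ltnn.
      by apply: leB hB'; lia.
    by split=> //; apply: cells_leW c'; lia.
  have [|t1 e1 [l1 c1]] := IHp st m' ap st3 st4 m'0 c'.
    by apply: leB hB'; lia.
  have er1 : reg (den p st) r = i by rewrite den_reg.
  (* The new counter is at most [m' + 1], since the old one was itself a cell; 4 is the cost of the
     increment. *)
  have c2 : cells_le (set_reg (den p st) r i.+1) (m' + t1 + 4).
    apply: cells_le_set_reg; last by apply: cells_leW c1; lia.
    by have := c'.1 r; rewrite er; lia.
  have n34 r' : r' \in [:: 3; 4] -> (r' == r) = false.
    by move=> h; apply/negP => /eqP e; rewrite -e h in r34.
  have [||||||||t2 e2 [l2 c3]] := IH i.+1 (set_reg (den p st) r i.+1) (m' + t1 + 4).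
  + by rewrite addSnnS.
  + by rewrite /= eqxx.
  + by rewrite /= nbr den_reg.
  + by rewrite /= (n34 3) // den_reg // (admissible_written_regs ap).
  + by rewrite /= (n34 4) // den_reg // (admissible_written_regs ap).
  + by lia.
  + exact: c2.
  + by apply: leB hB'; rewrite ?mulSn; lia.
  exists (4 + (t1 + 4) + t2).
    apply: (@ExWhileTrue _ _ _ 1 _ (set_reg (den p st) r i.+1)) => //.
    + rewrite (eval_value c') //=; last by apply: leB hB'; lia.
      by rewrite er enb (_ : i < x) //; lia.
    + apply: ExSeq e1 _.
      have -> : i.+1 = value (den p st) (Add (Reg r) (Cst 1)).
        by rewrite /= er1 addn1.
      apply: (@ExSetReg _ _ (Add (Reg r) (Cst 1))).
      rewrite (eval_value c1) //=.
      by apply: leB hB'; lia.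
  split; first by rewrite mulSn; lia.
  by apply: cells_leW c3; lia.
Qed.

Fixpoint degree (p : prg) : nat :=
  match p with
  | PSeq p q | PIf _ p q => maxn (degree p) (degree q)
  | PFor _ _ p => (degree p).+1
  | _ => 0
  end.

Fixpoint time_cst (p : prg) : nat :=
  match p with
  | PSkip => 1
  | PSet _ e => (cost e).+1
  | PPut _ e1 e2 => (cost e1 + cost e2).+1
  | PSeq p q => time_cst p + time_cst q
  | PIf e p q => (cost e).+1 + (time_cst p + time_cst q)
  | PFor _ _ p => time_cst p + 14
  end.

Lemma time_le p N : 0 < N -> time p N <= time_cst p * N ^ degree p.
Proof.
move=> N0; have X k : 0 < N ^ k by rewrite expn_gt0 N0.
have M k l : N ^ k <= N ^ maxn k l /\ N ^ l <= N ^ maxn k l.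
  by split; rewrite leq_pexp2l // (leq_maxl, leq_maxr).
elim: p => //=; try by move=> *; rewrite muln1.
- move=> p IHp q IHq; have [h1 h2] := M (degree p) (degree q).
  rewrite mulnDl; apply: leq_add.
    by apply: leq_trans IHp _; rewrite leq_mul2l h1 orbT.
  by apply: leq_trans IHq _; rewrite leq_mul2l h2 orbT.
- move=> e p IHp q IHq; have [h1 h2] := M (degree p) (degree q).
  rewrite !mulnDl; apply: leq_add; first by rewrite leq_pmulr.
  apply: leq_add.
    by apply: leq_trans IHp _; rewrite leq_mul2l h1 orbT.
  by apply: leq_trans IHq _; rewrite leq_mul2l h2 orbT.
- move=> _ _ p IHp; rewrite expnS.
  move: (X (degree p)) IHp; move: (N ^ _) => Y Y0 IHp.
  have : N * time p N <= N * (time_cst p * Y) by rewrite leq_mul2l IHp orbT.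
  have : N <= N * Y by rewrite leq_pmulr.
  nia.
Qed.

Lemma exec_compile p : admissible p -> degree p <= 2 ->
  exists w C, 0 < w /\ forall n s, 1 < n -> cells_le s n -> reg s 3 <= n ->
    reg s 4 <= n ->
    exists2 t, exec (n ^ w) (compile p) s t (den p s) & t <= C * n ^ 2.
Proof.
move=> ap dp; pose C := time_cst p.
(* With [n > 1], [n + C * n ^ 2 + 2] is at most [(C + 3) * n ^ 2], hence at most [n ^ (C + 3 + 2)].
   Raising to [max_cost p] gives the exponent, and the successor makes the inequality strict. *)
exists (((C + 3) + 2) * max_cost p).+1, C; split=> // n s n1 c s3 s4.
have n0 : 0 < n by lia.
have tC : time p n <= C * n ^ 2.
  by apply: leq_trans (time_le p n0) _; rewrite leq_mul2l leq_pexp2l ?orbT.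
have [|t e [l _]] := @exec_den (n ^ (((C + 3) + 2) * max_cost p).+1) n p s n ap
    s3 s4 n0 c; last by exists t => //; apply: leq_trans l tC.
apply: (@leq_ltn_trans (n ^ (((C + 3) + 2) * max_cost p))); last by rewrite ltn_exp2l.
rewrite expnM; case: (max_cost p) => // k; rewrite leq_exp2r //.
apply: (@leq_trans ((C + 3) * n ^ 2)).
  by rewrite mulnDl; move: tC; move: (C * n ^ 2) => D; rewrite -mulnn; nia.
by rewrite expnD leq_mul2r (ltnW (ltn_expl _ n1)) orbT.
Qed.

(** * Rooted trees *)

(** The list [L] is an order of visits: the root comes at position 0 and every parent precedes its
    children. The root is its own parent, so that iterating [par] is total and yields the
    ancestors. *)
Record rooted_by (T : finType) (e : rel T) (r : T) (L : seq T) (par : T -> T) :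
    Prop := RootedBy {
  rooted_uniq : uniq L;
  rooted_mem : forall x, x \in L;
  rooted_root : index r L = 0;
  rooted_parr : par r = r;
  rooted_par : forall x, x != r -> e (par x) x /\ index (par x) L < index x L
}.

(* The n - 1 parent edges are distinct, so they exhaust a list of n - 1 edges. *)
Lemma parent_edges (T : finType) (e : rel T) r L par (l : seq (T * T)) :
  rooted_by e r L par -> lists_edges e l -> size l = #|T|.-1 ->
  forall x y, e x y -> (x != r /\ par x = y) \/ (y != r /\ par y = x).
Proof.
move=> RB le sl.
(* [norm] turns a listed edge into the pair (later vertex, earlier vertex); a parent edge becomes
   [(x, par x)] whichever way it is listed. *)
pose norm (q : T * T) := if index q.1 L < index q.2 L then (q.2, q.1) else q.
pose s1 := [seq (x, par x) | x <- enum T & x != r].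
have u1 : uniq s1.
  rewrite map_inj_uniq; last by move=> x y [].
  by rewrite filter_uniq // enum_uniq.
have sub1 : {subset s1 <= map norm l}.
  move=> _ /mapP[x + ->]; rewrite mem_filter => /andP[xr _].
  have [ex ix] := rooted_par RB xr.
  move: ex; rewrite le => /orP[] h; apply/mapP; [exists (par x, x)|exists (x, par x)] => //.
    by rewrite /norm /= ix.
  by rewrite /norm /= ltnNge (ltnW ix).
have sz : size (map norm l) <= size s1.
  rewrite !size_map sl.
  rewrite -(cardC1 r) cardE; apply: uniq_leq_size; rewrite ?enum_uniq // => x.
  by rewrite !mem_enum mem_filter mem_enum !inE => ->.
have [_ e12] := uniq_min_size u1 sub1 sz.
have key x y : (x, y) \in l -> (x != r /\ par x = y) \/ (y != r /\ par y = x).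
  move=> xyl; have : norm (x, y) \in s1 by rewrite e12 map_f.
  case/mapP=> z; rewrite mem_filter => /andP[zr _]; rewrite /norm /=.
  by case: ifP => _ [-> ->]; [right|left].
move=> x y; rewrite le => /orP[/key //|/key]; case; by [right|left].
Qed.

Section Rooted.

Variables (T : finType) (e : rel T) (r : T) (L : seq T) (par : T -> T).
Hypothesis RB : rooted_by e r L par.
Hypothesis PE :
  forall x y, e x y -> (x != r /\ par x = y) \/ (y != r /\ par y = x).

Definition anc (x y : T) : bool := fconnect par y x.

Lemma anc_refl x : anc x x. Proof. exact: connect0. Qed.

Lemma anc_trans : transitive anc.
Proof. by move=> y x z xy yz; apply: connect_trans yz xy. Qed.

Lemma anc_par x : anc (par x) x. Proof. exact: fconnect1. Qed.

Lemma ancE x y : anc x y = (x == y) || anc x (par y).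
Proof.
apply/idP/idP.
- case/connectP=> [[|z p]] /=; first by move=> _ ->; rewrite eqxx.
  case/andP=> /eqP <- h ->; apply/orP; right.
  by apply/connectP; exists p.
- case/orP=> [/eqP ->|h]; first exact: anc_refl.
  exact: anc_trans h (anc_par y).
Qed.

Lemma par_index x : x != r -> index (par x) L < index x L.
Proof. by case/(rooted_par RB). Qed.

Lemma par_ind (P : T -> Prop) :
  P r -> (forall x, x != r -> P (par x) -> P x) -> forall x, P x.
Proof.
move=> Pr PS x; have [k] := ubnP (index x L); elim: k x => // k IH x xk.
have [-> //|xr] := eqVneq x r; apply: PS => //; apply: IH.
exact: leq_trans (par_index xr) xk.
Qed.

Lemma anc_root x : anc r x.
Proof.
elim/par_ind: x => [|x xr h]; first exact: anc_refl.
by rewrite ancE h orbT.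
Qed.

Lemma anc_of_root x : anc x r = (x == r).
Proof.
apply/idP/eqP => [|->]; last exact: anc_refl.
case/connectP=> p; elim: p => [|y p IH] /=; first by [].
by rewrite (rooted_parr RB) => /andP[/eqP <-] /IH h /h.
Qed.

Lemma anc_index x y : anc x y -> index x L <= index y L.
Proof.
elim/par_ind: y => [|y yr IH]; first by rewrite anc_of_root => /eqP ->.
rewrite ancE => /orP[/eqP -> //|/IH h].
exact: leq_trans h (ltnW (par_index yr)).
Qed.

Lemma index_inj_rooted x y : index x L = index y L -> x = y.
Proof.
move=> h; rewrite -(nth_index x (rooted_mem RB x)) h nth_index //.
exact: rooted_mem RB y.
Qed.

Lemma anc_antisym x y : anc x y -> anc y x -> x = y.
Proof.
move=> /anc_index xy /anc_index yx; apply: index_inj_rooted.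
by apply/eqP; rewrite eqn_leq xy yx.
Qed.

Lemma anc_index_lt x y : anc x y -> x != y -> index x L < index y L.
Proof.
move=> xy nxy; rewrite ltn_neqAle anc_index // andbT.
by apply: contra nxy => /eqP /index_inj_rooted ->.
Qed.

Lemma anc_total x y z : anc x z -> anc y z -> anc x y || anc y x.
Proof.
elim/par_ind: z => [|z zr IH].
  by rewrite !anc_of_root => /eqP -> /eqP ->; rewrite anc_refl.
rewrite [anc x z]ancE [anc y z]ancE => /orP[/eqP ->|xz] /orP[/eqP ->|yz].
- by rewrite anc_refl.
- by rewrite (anc_trans yz (anc_par z)) orbT.
- by rewrite (anc_trans xz (anc_par z)).
- exact: IH.
Qed.

(** A path that does not leave [x] towards its parent descends at every step: each next vertex is a
    child, and turning back up would repeat a vertex. So it is the chain between its two ends. *)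
Lemma down_path p x z : path e x p -> uniq (x :: p) ->
  (x == r) || (Some (par x) != ohead p) ->
  (z \in x :: p) = anc x z && anc z (last x p).
Proof.
elim: p x z => [|y p IH] x z.
  move=> _ _ _; rewrite inE /=; apply/eqP/andP => [->|[h1 h2]].
    by rewrite anc_refl.
  exact: anc_antisym.
rewrite /= => /andP[exy py] /andP[xp up] hx.
have [yr yx] : y != r /\ par y = x.
  case: (PE exy) => // -[xr yx]; move: hx; rewrite (negbTE xr) yx /=.
  by rewrite eqxx.
have hy : (y == r) || (Some (par y) != ohead p).
  rewrite yx; apply/orP; right; apply: contra xp; case: (p) => //= a p' /eqP[->].
  by rewrite !inE eqxx orbT.
have xy : anc x y by rewrite -yx anc_par.
rewrite inE (IH y z py up hy).
have yl : anc y (last y p).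
  have: y \in y :: p by rewrite inE eqxx.
  by rewrite IH // => /andP[].
apply/orP/andP => [[/eqP ->|/andP[yz zl]]|[xz zl]].
- by rewrite anc_refl (anc_trans xy yl).
- by rewrite (anc_trans xy yz) zl.
- have /orP[yz|zy] := anc_total yl zl; first by right; rewrite yz.
  move: zy; rewrite ancE yx => /orP[/eqP ->|zx].
    by right; rewrite anc_refl.
  by left; apply/eqP; apply: anc_antisym.
Qed.

Lemma tree_leE x y : tree_le e r x y <-> anc x y.
Proof.
split=> [[p [pp up lp xp]]|xy].
  by move: xp; rewrite (down_path _ pp up) ?eqxx // lp => /andP[].
suff [p [pp up lp mp]] : exists p, [/\ path e r p, uniq (r :: p), last r p = y &
    forall z, z \in r :: p -> anc z y].
  exists p; split=> //; by rewrite (down_path _ pp up) ?eqxx // lp xy anc_root.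
elim/par_ind: y {xy} => [|y yr [p [pp up lp mp]]].
  by exists [::]; split=> // z; rewrite inE => /eqP ->; apply: anc_refl.
have [ey iy] := rooted_par RB yr.
exists (rcons p y); split.
- by rewrite rcons_path pp lp.
(* The vertex [y] is new: all vertices of the path so far are ancestors of [par y], hence have
   smaller positions than [y]. *)
- rewrite -rcons_cons rcons_uniq up andbT; apply/negP => /mp /anc_index; lia.
- by rewrite last_rcons.
- move=> z; rewrite -rcons_cons mem_rcons inE => /orP[/eqP ->|/mp h].
    exact: anc_refl.
  by rewrite ancE h orbT.
Qed.

(** A path climbs to an apex [m] and descends from it. Upward steps are peeled off one at a time;
    once a step is not upward, [down_path] describes the rest, with the current vertex as apex. *)
Lemma path_anc p q S : path_with_ends e p q S ->
  exists m, [/\ anc m p, anc m q,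
    forall z, anc z p -> anc z q -> anc z m &
    forall x, (x \in S) = anc m x && (anc x p || anc x q)].
Proof.
case=> w [pw uw lw Sw].
suff [m [h1 h2 h3 h4]] : exists m, [/\ anc m p, anc m q,
    forall z, anc z p -> anc z q -> anc z m &
    forall x, (x \in p :: w) = anc m x && (anc x p || anc x q)].
  by exists m; split=> // x; rewrite Sw.
elim: w p pw uw lw {Sw} => [|y w IH] p.
  move=> _ _ /= <-; exists p; split; rewrite ?anc_refl // => x.
  rewrite inE orbb; apply/eqP/andP => [->|[]]; first by rewrite anc_refl.
  by move=> *; apply: anc_antisym.
move=> pw uw lw; have [epy pw'] := andP pw; have [pyw uw'] := andP uw.
have [pn|] := boolP ((p == r) || (Some (par p) != ohead (y :: w))).
  exists p; have D z := down_path z pw uw pn.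
  have pq : anc p q by move: (D p); rewrite lw inE eqxx anc_refl => /esym.
  split=> // [|x]; first exact: anc_refl.
  rewrite D lw; case px: (anc p x) => //=; case xp: (anc x p) => //=.
  exact: anc_trans xp pq.
rewrite negb_or negbK /= => /andP[pr /eqP[yE]].
have [m [my mq lm Sm]] := IH y pw' uw' lw.
have mp : anc m p by rewrite ancE yE my orbT.
exists m; split=> // [z|x].
  rewrite ancE yE => /orP[/eqP -> pq|]; last exact: lm.
  (* Were [p] itself an ancestor of [q], it would lie between the apex and [q], hence occur again on
     the rest of the path. *)
  by case/negP: pyw; rewrite Sm mp pq orbT.
rewrite inE Sm [anc x p]ancE yE; case: eqVneq => [->|_] //=.
by rewrite mp.
Qed.


End Rooted.

Lemma rooted_size (n : nat) (e : rel 'I_n) r L par :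
  rooted_by e r L par -> size L = n.
Proof.
move=> RB; rewrite -(card_uniqP (rooted_uniq RB)) -[RHS]card_ord.
by apply: eq_card => x; rewrite (rooted_mem RB).
Qed.

Lemma rooted_index_ltn (n : nat) (e : rel 'I_n) r L par :
  rooted_by e r L par -> forall x, index x L < n.
Proof.
move=> RB x; apply: (@leq_trans (size L)); last by rewrite (rooted_size RB).
by rewrite index_mem (rooted_mem RB).
Qed.

(** * Rooting a tree *)

Section RootStage.

Variables (E1 E2 ORD POS PAR nb rr : nat).

(** The counter is incremented before it is written to [POS], so stored positions start at 1 and the
    initial 0 means not yet visited. *)
Definition visit_prg (rx ry : nat) : prg :=
  PSeq (PPut ORD (Reg 5) (Reg ry))
  (PSeq (PSet 5 (Add (Reg 5) (Cst 1)))
  (PSeq (PPut POS (Reg ry) (Reg 5))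
        (PPut PAR (Reg ry) (Reg rx)))).

Definition seen_expr (rx : nat) : expr := Lt (Cst 0) (Get POS (Reg rx)).
Definition new_expr (rx : nat) : expr := Eq (Get POS (Reg rx)) (Cst 0).

Definition scan_prg : prg :=
  PSeq (PSet 8 (Get E1 (Reg 7)))
  (PSeq (PSet 9 (Get E2 (Reg 7)))
  (PIf (Mul (seen_expr 8) (new_expr 9)) (visit_prg 8 9)
  (PIf (Mul (seen_expr 9) (new_expr 8)) (visit_prg 9 8) PSkip))).

(** The root is visited with itself as parent. A sweep has [nb] rounds although there is one edge
    less, because only registers 3 and 4 may bound a loop. The surplus cells read as the pair (0,
    0), whose ends are either both seen or both new, so [scan_prg] ignores it. *)
Definition root_prg : prg :=
  PSeq (PSet 5 (Cst 0))
  (PSeq (visit_prg rr rr) (PFor 6 nb (PFor 7 nb scan_prg))).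

Hypothesis arrays_neq : uniq [:: ORD; POS; PAR; E1; E2].
Hypothesis nb34 : nb \in [:: 3; 4].
Hypothesis rr01 : rr \in [:: 0; 1].

Variables (n : nat) (e : rel 'I_n) (r : 'I_n).

Definition visited (st : state) (L : seq 'I_n) : Prop :=
  [/\ reg st 5 = size L, uniq L, r \in L /\ index r L = 0,
      (forall x, x \in L -> arr st ORD (index x L) = x) /\
      (forall x : 'I_n, arr st POS x = if x \in L then (index x L).+1 else 0) &
      forall x, x \in L -> exists2 z, z \in L & arr st PAR x = val z /\
        (if x == r then z = r else e z x /\ index z L < index x L)].

Lemma index_rcons_old (T : eqType) (L : seq T) (x y : T) :
  x \in L -> index x (rcons L y) = index x L.
Proof. by move=> xL; rewrite -cats1 index_cat xL. Qed.

Lemma index_rcons_new (T : eqType) (L : seq T) (y : T) :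
  y \notin L -> index y (rcons L y) = size L.
Proof. by move=> yL; rewrite -cats1 index_cat (negbTE yL) /= eqxx addn0. Qed.

Lemma visit_prg_spec st L (x y : 'I_n) rx ry :
  rx != 5 -> ry != 5 -> reg st rx = x -> reg st ry = y ->
  visited st L -> x \in L -> y \notin L -> e x y ->
  visited (den (visit_prg rx ry) st) (rcons L y).
Proof.
move=> /negbTE rx5 /negbTE ry5 ex ey [cL uL [rL iL] [oL pL] parL] xL yL exy.
have [op oq pq] : [/\ ORD != POS, ORD != PAR & POS != PAR].
  by move: arrays_neq; rewrite /= !inE !negb_or => /and5P[/and4P[-> -> _ _] /and3P[->]].
have [qo qp po] : [/\ PAR != ORD, PAR != POS & POS != ORD].
  by rewrite [PAR == _]eq_sym [PAR == POS]eq_sym [POS == ORD]eq_sym.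
have yr : (y == r) = false by apply/negP => /eqP E; rewrite -E (negbTE yL) in rL.
have ynx z : z \in L -> (val z == val y) = false.
  by move=> zL; apply/negP => /eqP /val_inj E; rewrite -E zL in yL.
split=> /=.
- by rewrite cL size_rcons addn1.
- by rewrite rcons_uniq yL uL.
- by rewrite mem_rcons inE rL orbT index_rcons_old.
- rewrite rx5 ry5 /= (negbTE op) (negbTE oq) (negbTE pq) (negbTE po) /= eqxx /= cL ey.
  split=> [x'|x']; rewrite mem_rcons inE.
    case/orP=> [/eqP ->|x'L]; first by rewrite index_rcons_new // eqxx.
    rewrite index_rcons_old //; case: eqP => [E|_]; last exact: oL.
    by move: x'L; rewrite -index_mem E ltnn.
  rewrite eqxx /=; have [->|ne] := eqVneq x' y.
    by rewrite eqxx /= index_rcons_new // addn1.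
  case: eqP => [/val_inj E|_]; first by rewrite E eqxx in ne.
  by rewrite pL /=; case: ifP => // x'L; rewrite index_rcons_old.
- rewrite rx5 ry5 /= (negbTE qo) (negbTE qp) /= eqxx /= ey ex => x'.
  rewrite mem_rcons inE => /orP[/eqP ->|x'L].
    exists x; first by rewrite mem_rcons inE xL orbT.
    rewrite eqxx yr; split=> //; split=> //.
    by rewrite index_rcons_old // index_rcons_new // index_mem.
  have [z zL [h1 h2]] := parL x' x'L; exists z.
    by rewrite mem_rcons inE zL orbT.
  rewrite ynx //; split=> //.
  by rewrite !index_rcons_old.
Qed.

Hypothesis e_sym : symmetric e.

Lemma scan_prg_spec st L (x y : 'I_n) :
  visited st L -> arr st E1 (reg st 7) = x -> arr st E2 (reg st 7) = y ->
  x = y \/ e x y ->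
  exists L', [/\ visited (den scan_prg st) L', {subset L <= L'},
    x \in L -> y \in L' & y \in L -> x \in L'].
Proof.
move=> vL ex ey exy; have [_ _ _ [_ pL] _] := vL.
pose s2 := set_reg (set_reg st 8 (arr st E1 (reg st 7))) 9 (arr st E2 (reg st 7)).
have -> : den scan_prg st =
  if (0 < arr s2 POS (reg s2 8)) * (arr s2 POS (reg s2 9) == 0) != 0
  then den (visit_prg 8 9) s2
  else if (0 < arr s2 POS (reg s2 9)) * (arr s2 POS (reg s2 8) == 0) != 0
  then den (visit_prg 9 8) s2 else s2 by [].
have e8 : reg s2 8 = x by rewrite /= ex.
have e9 : reg s2 9 = y by rewrite /= ey.
have v2 : visited s2 L by exact: vL.
have p2 (z : 'I_n) : arr s2 POS z = if z \in L then (index z L).+1 else 0 by exact: pL.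
have subr z : {subset L <= rcons L z}.
  by move=> u uL; rewrite mem_rcons inE uL orbT.
rewrite e8 e9 !p2.
case xL: (x \in L); case yL: (y \in L); rewrite /= ?eqxx.
- by exists L; split.
- exists (rcons L y); split=> //; last by rewrite mem_rcons mem_head.
  apply: (@visit_prg_spec s2 L x y 8 9) => //; first by rewrite yL.
  by case: exy => // E; rewrite -E xL in yL.
- exists (rcons L x); split=> //; last by rewrite mem_rcons mem_head.
  apply: (@visit_prg_spec s2 L y x 9 8) => //; first by rewrite xL.
  by case: exy => [E|]; [rewrite -E xL in yL|rewrite e_sym].
- by exists L; split.
Qed.

Hypothesis e_conn : connected e.

Lemma root_prg_spec s :
  reg s nb = n -> reg s rr = r -> (forall x : 'I_n, arr s POS x = 0) ->
  (forall j, j < n -> exists x y : 'I_n,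
     [/\ arr s E1 j = x, arr s E2 j = y & x = y \/ e x y]) ->
  (forall x y, e x y -> exists2 j, j < n &
     (arr s E1 j = x /\ arr s E2 j = y) \/ (arr s E1 j = y /\ arr s E2 j = x)) ->
  exists L par, [/\ rooted_by e r L par,
    forall x, arr (den root_prg s) ORD (index x L) = val x,
    forall x : 'I_n, arr (den root_prg s) POS x = (index x L).+1 &
    forall x : 'I_n, arr (den root_prg s) PAR x = val (par x)].
Proof.
move=> en er p0 he1 he2.
have [op oq pq] : [/\ ORD != POS, ORD != PAR & POS != PAR].
  by move: arrays_neq; rewrite /= !inE !negb_or => /and5P[/and4P[-> -> _ _] /and3P[->]].
have [n1 n2] : (E1 \notin [:: ORD; POS; PAR]) /\ (E2 \notin [:: ORD; POS; PAR]).
  move: arrays_neq; rewrite /= !inE !negb_or !(eq_sym E1).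
  rewrite !(eq_sym E2).
  by case/and5P=> /and4P[_ _ -> ->] /and3P[_ -> ->] /andP[-> ->].
have [qo qp po] : [/\ PAR != ORD, PAR != POS & POS != ORD].
  by rewrite [PAR == _]eq_sym [PAR == POS]eq_sym [POS == ORD]eq_sym.
have rr5 : (rr == 5) = false by move: rr01; rewrite !inE => /orP[]/eqP ->.
set s0 := den (visit_prg rr rr) (set_reg s 5 0).
have -> : den root_prg s = den (PFor 6 nb (PFor 7 nb scan_prg)) s0 by [].
have v0 : visited s0 [:: r].
  split=> //=; rewrite ?eqxx ?mem_head //=.
  - rewrite rr5 /= (negbTE op) (negbTE oq) (negbTE pq) (negbTE po) /= er.
    split=> x; rewrite !inE ?eqxx; first by move/eqP=> ->; rewrite !eqxx.
    rewrite [r == x]eq_sym /=; have [->|ne] := eqVneq x r; first by rewrite eqxx.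
    by case: eqP => [/val_inj E|_] /=; [rewrite E eqxx in ne|exact: p0].
  - rewrite rr5 /= (negbTE qo) (negbTE qp) /= er => x.
    by rewrite inE => /eqP ->; exists r; rewrite ?mem_head // !eqxx.
have nbs0 : reg s0 nb = n.
  by rewrite -en; move: nb34; rewrite !inE => /orP[]/eqP ->.
have eqE1 j : arr s0 E1 j = arr s E1 j by rewrite den_arr.
have eqE2 j : arr s0 E2 j = arr s E2 j by rewrite den_arr.
have w1 : E1 \notin written_arrs (PFor 7 nb scan_prg).
  by move: n1; rewrite /= !inE !negb_or => /and3P[-> -> ->].
have w2 : E2 \notin written_arrs (PFor 7 nb scan_prg).
  by move: n2; rewrite /= !inE !negb_or => /and3P[-> -> ->].
(* A sweep adds every neighbour of the vertices known before it, so after [i] sweeps all vertices at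
   distance at most [i] from the root have been visited, possibly more. *)
pose I i st := exists2 L, visited st L &
  forall p, path e r p -> size p <= i -> last r p \in L.
have : I (reg s0 nb) (den (PFor 6 nb (PFor 7 nb scan_prg)) s0).
  apply: den_for_ind.
    by exists [:: r] => // -[] //=; rewrite mem_head.
  move=> i st _ _ fr fa [L vL rL].
  have nbst : reg st nb = n.
    by rewrite fr //; move: nb34; rewrite !inE => /orP[]/eqP ->.
  pose J j st' := exists2 L', visited st' L' & {subset L <= L'} /\
    forall k (x y : 'I_n), k < j -> arr s E1 k = x -> arr s E2 k = y ->
      (x \in L -> y \in L') /\ (y \in L -> x \in L').
  have : J (reg st nb) (den (PFor 7 nb scan_prg) st).
    apply: den_for_ind; first by exists L; [exact: vL|split].
    move=> j st' jn ej fr' fa' [L' vL' [sL kL]].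
    have E1st k : arr st' E1 k = arr s E1 k by rewrite fa' // fa // eqE1.
    have E2st k : arr st' E2 k = arr s E2 k by rewrite fa' // fa // eqE2.
    rewrite nbst in jn; have [x [y [ex ey exy]]] := he1 j jn.
    have [||L2 [vL2 sL2 h1 h2]] := @scan_prg_spec st' L' x y vL' _ _ exy.
    - by rewrite ej E1st.
    - by rewrite ej E2st.
    exists L2; first exact: vL2.
    split=> [z /sL /sL2 //|k x' y'].
    rewrite ltnS leq_eqVlt => /orP[/eqP ->|kj ex' ey'].
      rewrite ex ey => /val_inj <- /val_inj <-.
      by split=> /sL; [apply: h1|apply: h2].
    by have [h3 h4] := kL k x' y' kj ex' ey'; split=> [/h3|/h4] /sL2.
  rewrite nbst => -[L' vL' [sL kL]]; exists L'; first exact: vL'.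
  move=> p; case/lastP: p => [|p y]; first by move=> _ _; apply/sL/(rL [::]).
  rewrite rcons_path size_rcons last_rcons => /andP[pp epy] sp.
  have pL := rL p pp sp; have [j jn] := he2 _ _ epy.
  by case=> -[h1 h2]; have [h3 h4] := kL _ _ _ jn h1 h2; [apply: h3|apply: h4].
rewrite nbs0; set s' := den _ _ => -[L [_ uL [rL iL] [oL pL] parL] aL].
have allL (x : 'I_n) : x \in L.
  have /connectP[p pp ->] := e_conn r x.
  have [p' pp' up' _] := shortenP pp; apply: aL => //.
  by have := max_card (mem (r :: p')); rewrite (card_uniqP up') card_ord => /ltnW.
pose par (x : 'I_n) : 'I_n := odflt r (insub (arr s' PAR x)).
have parE (x : 'I_n) : arr s' PAR x = val (par x).
  by have [z _ [h _]] := parL x (allL x); rewrite /par h valK.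
exists L, par; split=> // [|x|x]; [|exact: oL|by rewrite pL allL].
have parP x : if x == r then par x = r else e (par x) x /\ index (par x) L < index x L.
  have [z _ [h1 h2]] := parL x (allL x).
  suff -> : par x = z by [].
  by apply: val_inj; rewrite -parE.
split=> // [|x xr]; first by have := parP r; rewrite eqxx.
by have := parP x; rewrite (negbTE xr).
Qed.

End RootStage.

(** * Ancestors and least common ancestors *)

Lemma mat_index_inj n (x x' y y' : 'I_n) :
  (x * n + y == x' * n + y') = (x == x') && (y == y').
Proof.
apply/eqP/andP => [|[/eqP -> /eqP ->] //].
have n0 : 0 < n by case: n x {x' y y'} => // -[].
move=> h; have := congr1 (divn^~ n) h; have := congr1 (modn^~ n) h.
rewrite !modnMDl !divnMDl // !modn_small // !divn_small // !addn0.
by move=> /val_inj -> /val_inj ->.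
Qed.

Section AncStage.

Variables (ORD PAR ANC nb : nat).

(** Row [x] marks the ancestors of [x]: it is the row of the parent, with [x] added. Rows are filled
    in the order of visits, so the parent's row is complete. The root is its own parent and has no
    earlier row to copy; its zeros are written directly. *)
Definition anc_row_prg : prg :=
  PIf (Eq (Reg 7) (Reg 8))
    (PPut ANC (Add (Mul (Reg 8) (Reg nb)) (Reg 7)) (Cst 1))
  (PIf (Eq (Reg 6) (Cst 0))
    (PPut ANC (Add (Mul (Reg 8) (Reg nb)) (Reg 7)) (Cst 0))
    (PPut ANC (Add (Mul (Reg 8) (Reg nb)) (Reg 7))
       (Get ANC (Add (Mul (Get PAR (Reg 8)) (Reg nb)) (Reg 7))))).

Definition anc_prg : prg :=
  PFor 6 nb (PSeq (PSet 8 (Get ORD (Reg 6))) (PFor 7 nb anc_row_prg)).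

Hypothesis arrays_neq : (ORD != ANC) && (PAR != ANC).
Hypothesis nb34 : nb \in [:: 3; 4].

Variables (n : nat) (e : rel 'I_n) (r : 'I_n) (L : seq 'I_n) (par : 'I_n -> 'I_n).
Hypothesis RB : rooted_by e r L par.

Definition holds_anc (st : state) : Prop :=
  forall x y : 'I_n, arr st ANC (x * n + y) = anc par y x.

Lemma anc_prg_spec s : reg s nb = n ->
  (forall x, arr s ORD (index x L) = val x) ->
  (forall x : 'I_n, arr s PAR x = val (par x)) ->
  holds_anc (den anc_prg s).
Proof.
move=> en hO hP; have [oa pa] := andP arrays_neq.
have sL := rooted_size RB.
pose I i st := forall x y : 'I_n, index x L < i ->
  arr st ANC (x * n + y) = anc par y x.
have : I (reg s nb) (den anc_prg s).
  apply: den_for_ind => // i st; rewrite en => iN ei fr fa Ii.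
  have nbst : reg st nb = n.
    by rewrite fr //; move: nb34; rewrite !inE => /orP[]/eqP ->.
  rewrite -sL in iN; pose x := nth r L i.
  have ix : index x L = i by rewrite index_uniq // (rooted_uniq RB).
  pose st1 := set_reg st 8 (val x).
  have -> : den (PSeq (PSet 8 (Get ORD (Reg 6))) (PFor 7 nb anc_row_prg)) st =
      den (PFor 7 nb anc_row_prg) st1.
    rewrite /st1 [RHS]/= -hO ix /= ei fa //=.
    by rewrite !inE (negbTE oa).
  pose J j st' := (forall x' y : 'I_n, x' != x ->
      arr st' ANC (x' * n + y) = arr st ANC (x' * n + y)) /\
    (forall y : 'I_n, y < j -> arr st' ANC (x * n + y) = anc par y x).
  have nb1 : reg st1 nb = n.
    by move: nb34 nbst; rewrite !inE => /orP[]/eqP ->.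
  have : J (reg st1 nb) (den (PFor 7 nb anc_row_prg) st1).
    apply: den_for_ind => // j st'; rewrite nb1 => jn ej fr' fa' [J1 J2].
    pose yj : 'I_n := Ordinal jn.
    have e6 : reg st' 6 = i by rewrite fr' //= ei.
    have e8 : reg st' 8 = x by rewrite fr'.
    have enb : reg st' nb = n.
      by rewrite fr' //; move: nb34; rewrite !inE => /orP[]/eqP ->.
    have eP : arr st' PAR (val x) = par x.
      rewrite fa'; last by rewrite /= !inE (negbTE pa).
      rewrite /= fa; last by rewrite /= !inE (negbTE pa).
      by rewrite hP.
    have Jset (v : nat) : v = anc par yj x ->
        J j.+1 (set_reg (set_arr st' ANC (x * n + j) v) 7 j.+1).
      move=> ->; split=> [x' y nx|y].
        by rewrite /= eqxx (mat_index_inj x' x y yj) (negbTE nx) /= J1.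
      rewrite ltnS /= eqxx (mat_index_inj x x y yj) eqxx /=.
      have [-> //|ne] := eqVneq y yj; rewrite leq_eqVlt => /orP[/eqP E|/J2 //].
      by case/eqP: ne; apply: val_inj.
    rewrite /= ej e8 e6 enb eP !eqb0 !negbK.
    case: eqP => [jx|jx] /=.
      apply: Jset; have -> : yj = x by apply: val_inj.
      by rewrite anc_refl.
    have yx : (yj == x) = false.
      by apply/eqP => E; apply: jx; rewrite -E.
    case: eqP => [i0|i0] /=.
      apply: Jset; have xr : x = r.
        by apply: (index_inj_rooted RB); rewrite ix i0 (rooted_root RB).
      by rewrite {1}xr (anc_of_root RB) -xr yx.
    have xr : x != r.
      by apply/eqP => E; apply: i0; rewrite -ix E (rooted_root RB).
    have ipx := par_index RB xr.
    apply: Jset; rewrite ancE yx /= (J1 (par x) yj); last first.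
      by apply/eqP => E; rewrite E ltnn in ipx.
    by apply: Ii; rewrite -ix.
  rewrite nb1 => -[J1 J2] x' y; rewrite ltnS leq_eqVlt => ix'.
  have [->|nx] := eqVneq x' x; first by apply: J2.
  rewrite [LHS]/= J1 //; apply: Ii; case/orP: ix' => // /eqP E.
  by case/eqP: nx; apply: (index_inj_rooted RB); rewrite ix.
rewrite en => h x y; apply: h.
apply: (@leq_trans (size L)); last by rewrite sL.
  by rewrite index_mem (rooted_mem RB).
Qed.

End AncStage.

Section LcaStage.

(* [mb] holds the number of paths, [nb] the number of vertices of the tree. *)
Variables (ORD ANC P Q MIN nb mb : nat).

(** Every common ancestor overwrites [MIN]; as candidates come in the order of visits, the deepest
    one remains. *)
Definition lca_row_prg : prg :=
  PSeq (PSet 8 (Get ORD (Reg 7)))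
  (PIf (Mul (Get ANC (Add (Mul (Get P (Reg 6)) (Reg nb)) (Reg 8)))
            (Get ANC (Add (Mul (Get Q (Reg 6)) (Reg nb)) (Reg 8))))
       (PPut MIN (Reg 6) (Reg 8)) PSkip).

Definition lca_prg : prg := PFor 6 mb (PFor 7 nb lca_row_prg).

Hypothesis arrays_neq :
  [&& ORD != MIN, ANC != MIN, P != MIN & Q != MIN].
Hypothesis nb34 : nb \in [:: 3; 4].

Variables (n : nat) (e : rel 'I_n) (r : 'I_n) (L : seq 'I_n) (par : 'I_n -> 'I_n).
Hypothesis RB : rooted_by e r L par.
Variables (m : nat) (p q : 'I_m -> 'I_n).

Definition lca_of (i : 'I_m) (z : 'I_n) : Prop :=
  [/\ anc par z (p i), anc par z (q i) &
    forall u, anc par u (p i) -> anc par u (q i) -> index u L <= index z L].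

Lemma lca_prg_spec s : reg s nb = n -> reg s mb = m ->
  (forall x, arr s ORD (index x L) = val x) ->
  holds_anc ANC par s ->
  (forall i : 'I_m, arr s P i = p i) -> (forall i : 'I_m, arr s Q i = q i) ->
  forall i : 'I_m, exists2 z, lca_of i z & arr (den lca_prg s) MIN i = val z.
Proof.
move=> en em hO hA hp hq; have /and4P[om am pm qm] := arrays_neq.
have sL := rooted_size RB.
pose I i st := forall j : 'I_m, j < i -> exists2 z, lca_of j z & arr st MIN j = val z.
suff : I (reg s mb) (den lca_prg s) by rewrite em => h i; apply: h.
apply: den_for_ind => // i st; rewrite em => im ei fr fa Ii.
have nbst : reg st nb = n.
  by rewrite fr //; move: nb34; rewrite !inE => /orP[]/eqP ->.
pose oi := Ordinal im.
pose com u := anc par u (p oi) && anc par u (q oi).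
(* The root comes first and is a common ancestor, so [MIN] is meaningful from the first round on. *)
pose J j st' := (forall k : 'I_m, k < i -> arr st' MIN k = arr st MIN k) /\
  (0 < j -> exists z, [/\ com z, arr st' MIN i = val z &
     forall u, com u -> index u L < j -> index u L <= index z L]).
have : J (reg st nb) (den (PFor 7 nb lca_row_prg) st).
  apply: den_for_ind => // j st'; rewrite nbst => jn ej fr' fa' [J1 J2].
  have e6 : reg st' 6 = i by rewrite fr'.
  have enb : reg st' nb = n.
    by rewrite fr' //; move: nb34; rewrite !inE => /orP[]/eqP ->.
  have F a k : a != MIN -> arr st' a k = arr s a k.
    by move=> h; rewrite fa' ?fa //= !inE (negbTE h).
  rewrite -sL in jn; pose x := nth r L j.
  have ix : index x L = j by rewrite index_uniq // (rooted_uniq RB).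
  have eO : arr st' ORD j = x by rewrite F // -ix hO.
  have eC : arr st' ANC (arr st' P i * n + x) * arr st' ANC (arr st' Q i * n + x)
      = com x.
    by rewrite !F // (hp oi) (hq oi) !hA mulnb.
  have -> : den lca_row_prg st' = if com x
      then set_arr (set_reg st' 8 (val x)) MIN i (val x) else set_reg st' 8 (val x).
    move: nb34; rewrite !inE /lca_row_prg /= ej eO e6 => /orP[]/eqP E;
    by rewrite E /= -E enb eC eqb0 negbK.
  case: ifP => cx.
    split=> [k ki|_].
      rewrite /= eqxx /= (_ : (val k == i) = false) ?J1 //.
      by apply/negP => /eqP E; rewrite E ltnn in ki.
    exists x; split=> //=; first by rewrite !eqxx.
    by move=> u _; rewrite ltnS ix.
  split=> // _.
  case: j jn ej J1 J2 x ix eO eC cx => [|j] jn ej J1 J2 x ix eO eC cx.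
    have xr : x = r by apply: (index_inj_rooted RB); rewrite ix (rooted_root RB).
    by move: cx; rewrite /com xr !(anc_root RB).
  have [//|z [cz ez hz]] := J2; exists z; split=> // u cu.
  rewrite ltnS leq_eqVlt => /orP[/eqP E|]; last exact: hz.
  have : u = x by apply: (index_inj_rooted RB); rewrite ix.
  by move=> E'; rewrite E' cx in cu.
rewrite nbst => -[J1 J2] k; rewrite ltnS leq_eqVlt => /orP[/eqP ki|ki].
  have -> : k = oi by apply: val_inj.
  have [|z [/andP[c1 c2] ez hz]] := J2; first by apply: leq_ltn_trans (ltn_ord r).
  exists z => //; split=> // u u1 u2; apply: hz; first by rewrite /com u1.
  apply: (@leq_trans (size L)); last by rewrite sL.
  by rewrite index_mem (rooted_mem RB).
by have [z lz ez] := Ii k ki; exists z => //; rewrite [LHS]/= J1.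
Qed.

End LcaStage.

(** * Ranks *)

Section Rank.

Variables (m : nat) (key : 'I_m -> nat).
Hypothesis key_inj : injective key.

(** Ranks run from 1 to [m]: the value 0 is left to mark empty cells and to start a search for a
    maximum. *)
Definition key_rank (x : 'I_m) : nat :=
  (count (fun y => key y < key x) (enum 'I_m)).+1.

Definition key_sort : seq 'I_m := sort (fun x y => key y <= key x) (enum 'I_m).

Lemma key_sort_decreasing : decreasing_list (fun x y => key x < key y) key_sort.
Proof.
split; first by rewrite perm_sort.
have : sorted gtn (map key key_sort).
  rewrite gtn_sorted_uniq_geq map_inj_uniq // sort_uniq enum_uniq sorted_map.
  by apply: sort_sorted => x y; apply: leq_total.
by rewrite sorted_map.
Qed.

(** In the decreasing list exactly the elements of smaller key follow [x], and there are
    [key_rank x - 1] of them. This gives the address at which [rank_prg] places [x], without any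
    sorting procedure. *)
Lemma nth_key_sort x0 x : nth x0 key_sort (m - key_rank x) = x.
Proof.
have [pe srt] := key_sort_decreasing.
have tr : transitive (fun x y : 'I_m => key y < key x).
  by move=> a b c h1 h2; apply: ltn_trans h2 h1.
have : x \in key_sort by rewrite (perm_mem pe) mem_enum.
have sz : size key_sort = m by rewrite (perm_size pe) size_enum_ord.
have : key_rank x = (count (fun y => key y < key x) key_sort).+1.
  by rewrite /key_rank; congr _.+1; apply/permP; rewrite perm_sym.
move: key_sort srt sz {pe} => l srt sz rkE xl.
case/splitPr: l / xl srt sz rkE => l1 l2.
rewrite sorted_pairwise // pairwise_cat /= => /and3P[h1 _ /andP[h2 _]].
rewrite size_cat count_cat /= ltnn => sz rkE.
have c1 : count (fun y => key y < key x) l1 = 0.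
  apply/eqP; rewrite -leqn0 leqNgt -has_count; apply/hasPn => y yl.
  by have /allP/(_ y yl)/andP[] := h1; rewrite -leqNgt => /ltnW.
have c2 : count (fun y => key y < key x) l2 = size l2.
  by apply/eqP; rewrite -all_count.
have -> : m - key_rank x = size l1 by move: sz; rewrite rkE c1 c2 /=; lia.
by rewrite nth_cat ltnn subnn.
Qed.

Lemma key_rank_le x : key_rank x <= m.
Proof.
apply: leq_trans (_ : size (enum 'I_m) <= m); last by rewrite size_enum_ord.
rewrite /key_rank; set a := fun _ => _.
rewrite -(count_predC a) -addn1 leq_add2l -has_count; apply/hasP.
by exists x; rewrite ?mem_enum // /a /= ltnn.
Qed.

Lemma key_rank_inj : injective key_rank.
Proof.
move=> x y h; rewrite -(nth_key_sort x x) h; exact: nth_key_sort.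
Qed.

Lemma key_rank_leE x y : (key_rank x <= key_rank y) = (key x <= key y).
Proof.
have mono a b : key a <= key b -> key_rank a <= key_rank b.
  by move=> h; rewrite ltnS; apply: sub_count => z /= /leq_trans; apply.
apply/idP/idP => [h|]; last exact: mono.
rewrite leqNgt; apply/negP => h'; have h2 := mono _ _ (ltnW h').
have/key_rank_inj E : key_rank x = key_rank y by apply/eqP; rewrite eqn_leq h h2.
by rewrite E ltnn in h'.
Qed.

End Rank.

Section RankStage.

Variables (MIN POSo POSs RK S mb : nat).

(** The key is recomputed at each comparison and never stored, because a product is not [small].
    Only the count of smaller keys is kept. *)
Definition key_expr (r : nat) : expr :=
  Add (Mul (Get POSo (Get MIN (Reg r))) (Reg mb)) (Get POSs (Reg r)).

Definition count_prg : prg :=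
  PIf (Lt (key_expr 7) (key_expr 6)) (PSet 8 (Add (Reg 8) (Cst 1))) PSkip.

Definition rank_prg : prg :=
  PFor 6 mb
  (PSeq (PSet 8 (Cst 1))
  (PSeq (PFor 7 mb count_prg)
  (PSeq (PPut RK (Reg 6) (Reg 8))
        (PPut S (Defs.Sub (Reg mb) (Reg 8)) (Reg 6))))).

Hypothesis arrays_neq : uniq [:: RK; S] &&
  all (fun a => a \notin [:: RK; S]) [:: MIN; POSo; POSs].
Hypothesis mb34 : mb \in [:: 3; 4].

Variables (m : nat) (key : 'I_m -> nat).
Hypothesis key_inj : injective key.

Lemma rank_prg_spec s : reg s mb = m ->
  (forall x : 'I_m, arr s POSo (arr s MIN x) * m + arr s POSs x = key x) ->
  (forall x : 'I_m, arr (den rank_prg s) RK x = key_rank key x) /\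
  holds_seq (den rank_prg s) S (map val (key_sort key)).
Proof.
move=> em hk; have /and5P[rs nM nO nS _] := arrays_neq.
have RS : (RK == S) = false by move: rs; rewrite /= inE andbT => /negbTE.
pose I i st := forall x : 'I_m, x < i -> arr st RK x = key_rank key x /\
  arr st S (m - key_rank key x) = x.
have H : I (reg s mb) (den rank_prg s).
  apply: den_for_ind => // i st; rewrite em => im ei fr fa Ii.
  pose xi := Ordinal im.
  have mbst : reg st mb = m.
    by rewrite fr //; move: mb34; rewrite !inE => /orP[]/eqP ->.
  pose st1 := set_reg st 8 1.
  have mb1 : reg st1 mb = m by move: mb34 mbst; rewrite !inE => /orP[]/eqP ->.
  pose J j st' := reg st' 8 =
    (count (fun y => key y < key xi) (take j (enum 'I_m))).+1.
  have : J (reg st1 mb) (den (PFor 7 mb count_prg) st1).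
    apply: den_for_ind; first by rewrite /J take0.
    move=> j st'; rewrite mb1 => jm ej fr' fa' Jj.
    pose xj := Ordinal jm.
    have e6 : reg st' 6 = i by rewrite fr' //= ei.
    have emb : reg st' mb = m.
      by rewrite fr' //; move: mb34; rewrite !inE => /orP[]/eqP ->.
    have F a k : a \notin [:: RK; S] -> arr st' a k = arr s a k.
      by move=> h; rewrite fa' // fa.
    have K (x : 'I_m) :
        arr st' POSo (arr st' MIN x) * m + arr st' POSs x = key x.
      by rewrite !F.
    have -> : den count_prg st' = if key xj < key xi
        then set_reg st' 8 (reg st' 8).+1 else st'.
      by rewrite /= ej e6 emb (K xj) (K xi) eqb0 negbK addn1.
    rewrite /J (take_nth xj) ?size_enum_ord // -cats1 count_cat /=.
    have -> : nth xj (enum 'I_m) j = xj by apply: val_inj; exact: nth_enum_ord.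
    by case: ifP => _; rewrite /= Jj ?addn0 ?addn1.
  rewrite mb1 /J take_oversize ?size_enum_ord // -/(key_rank key xi).
  set st2 := den _ st1 => J2.
  have e6 : reg st2 6 = i by rewrite /st2 den_reg.
  have emb : reg st2 mb = m.
    by rewrite -mb1 /st2 den_reg //; move: mb34; rewrite !inE => /orP[]/eqP ->.
  have -> : den (PSeq (PSet 8 (Cst 1)) (PSeq (PFor 7 mb count_prg)
      (PSeq (PPut RK (Reg 6) (Reg 8))
        (PPut S (Defs.Sub (Reg mb) (Reg 8)) (Reg 6))))) st =
      set_arr (set_arr st2 RK i (key_rank key xi)) S (m - key_rank key xi) i.
    by rewrite -[in LHS]/(den _ st1) /= -/st2 e6 J2 emb.
  move=> x; rewrite /= RS [S == RK]eq_sym RS !eqxx /= ltnS => xi'.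
  have [->|ne] := eqVneq x xi; first by rewrite !eqxx.
  have nv : (val x == i) = false by apply/negP => /eqP E; case/eqP: ne; apply: val_inj.
  have xlt : x < i by rewrite ltn_neqAle nv.
  rewrite nv; have [h1 h2] := Ii x xlt.
  have fst2 a k : arr st2 a k = arr st a k by rewrite /st2 den_arr.
  rewrite !fst2 h1 h2; split=> //; case: eqP => // E.
  case/eqP: ne; apply: (key_rank_inj key_inj).
  have := key_rank_le key x; have := key_rank_le key xi; lia.
rewrite em in H; split=> [x|k]; first by have [] := H x (ltn_ord x).
have sz : size (key_sort key) = m by rewrite size_sort size_enum_ord.
rewrite size_map sz => km; pose x0 := Ordinal km.
rewrite (nth_map x0) ?sz //; set x := nth x0 _ _.
have [_ h] := H x (ltn_ord x); apply: etrans h; congr (arr _ _ _).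
have u : uniq (key_sort key) by rewrite sort_uniq enum_uniq.
have lt : m - key_rank key x < size (key_sort key) by rewrite sz /key_rank; lia.
by apply/eqP; rewrite -(nth_uniq x0 _ _ u) ?lt ?sz // -/x (nth_key_sort key_inj).
Qed.

End RankStage.

(** * The loop of the algorithm *)

Section Argmax.

Variables (nb rb ri : nat) (cond val : expr).

Definition argmax_prg : prg :=
  PSeq (PSet rb (Cst 0))
  (PSeq (PSet ri (Cst 0))
  (PFor 7 nb
    (PIf (Mul cond (Lt (Reg rb) val))
      (PSeq (PSet rb val) (PSet ri (Add (Reg 7) (Cst 1)))) PSkip))).

Hypothesis regs_neq : uniq [:: 7; nb; rb; ri].

(** Positivity of [V] on candidates lets the first one beat the initial best value 0. The value
    expression has to be right only where [P] holds, which matters when the loop runs past the end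
    of a list. *)
Lemma argmax_prg_spec s N (P : pred 'I_N) (V : 'I_N -> nat) :
  reg s nb = N -> (forall j, P j -> 0 < V j) ->
  (forall st (j : 'I_N), reg st 7 = j ->
     (forall r, r \notin [:: 7; rb; ri] -> reg st r = reg s r) ->
     (forall a k, arr st a k = arr s a k) ->
     ((value st cond != 0) = P j) /\ (P j -> value st val = V j)) ->
  (forall r, r \notin [:: 7; rb; ri] -> reg (den argmax_prg s) r = reg s r) /\
  ((reg (den argmax_prg s) ri = 0 /\ forall j, ~~ P j) \/
   exists j, [/\ P j, reg (den argmax_prg s) ri = j.+1 &
                 forall k, P k -> V k <= V j]).
Proof.
move=> en V0 ev.
have [r7 i7 ir] : [/\ rb != 7, ri != 7 & ri != rb].
  move: regs_neq; rewrite /= !inE !negb_or => /and4P[/and3P[_ h1 h2] _ h3 _].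
  by rewrite eq_sym h1 eq_sym h2 eq_sym h3.
have [nr ni n7] : [/\ nb != rb, nb != ri & nb != 7].
  move: regs_neq; rewrite /= !inE !negb_or => /and4P[/and3P[h0 _ _] /andP[-> ->] _ _].
  by rewrite eq_sym h0.
split.
  move=> r rn; rewrite den_reg //; move: rn; rewrite /= !inE !negb_or.
  by case/and3P=> -> -> ->.
pose s1 := set_reg (set_reg s rb 0) ri 0.
pose I i st := forall (fr : forall r, r \notin [:: 7; rb; ri] -> reg st r = reg s r),
  (reg st rb = 0 /\ reg st ri = 0 /\ forall j : 'I_N, j < i -> ~~ P j) \/
  exists j : 'I_N, [/\ P j, reg st ri = j.+1, reg st rb = V j &
                 forall k : 'I_N, k < i -> P k -> V k <= V j].
pose body := PIf (Mul cond (Lt (Reg rb) val))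
  (PSeq (PSet rb val) (PSet ri (Add (Reg 7) (Cst 1)))) PSkip.
have -> : den argmax_prg s = den (PFor 7 nb body) s1 by [].
have n1 : reg s1 nb = N by rewrite /= (negbTE nr) (negbTE ni).
have ss1 r : r \notin [:: 7; rb; ri] -> reg s1 r = reg s r.
  by rewrite !inE !negb_or => /and3P[_ /negbTE h1 /negbTE h2]; rewrite /= h1 h2.
have : I (reg s1 nb) (den (PFor 7 nb body) s1).
  apply: den_for_ind.
    move=> _; left; rewrite /= (negbTE r7) (negbTE i7) !eqxx.
    by rewrite [rb == ri]eq_sym (negbTE ir).
  move=> i st; rewrite n1 => iN ei fr fa Ii _.
  have fr' r : r \notin [:: 7; rb; ri] -> reg st r = reg s r.
    by move=> h; rewrite fr ?ss1.
  have [hc hv] := ev st (Ordinal iN) ei fr' (fun a k => fa a k isT).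
  have eb : (value st cond * (reg st rb < value st val) != 0) =
      P (Ordinal iN) && (reg st rb < V (Ordinal iN)).
    rewrite muln_eq0 negb_or hc eqb0 negbK.
    by case: (boolP (P (Ordinal iN))) => [p|//]; rewrite hv.
  rewrite /body /= eb (negbTE r7) (negbTE i7); case: ifP => [/andP[p lt]|pf].
    right; exists (Ordinal iN).
    rewrite /= !eqxx [rb == ri]eq_sym (negbTE ir).
    rewrite [7 == rb]eq_sym (negbTE r7) ei addn1; split=> //; first exact: hv.
    move=> k; rewrite ltnS leq_eqVlt => /orP[/eqP E|ki] pk.
      by have -> : k = Ordinal iN by apply: val_inj.
    case: (Ii fr') => [[_ [_ h]]|[j [_ _ ej h]]]; first by rewrite (negbTE (h k ki)) in pk.
    by apply: leq_trans (h k ki pk) _; rewrite -ej; apply: ltnW.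
  case: (Ii fr') => [[e1 [e2 h]]|[j [pj e1 e2 h]]].
    left; split=> //; split=> // j; rewrite ltnS leq_eqVlt => /orP[/eqP E|]; last exact: h.
    have -> : j = Ordinal iN by apply: val_inj.
    by apply/negP => p; rewrite p e1 V0 in pf.
  right; exists j; split=> // k; rewrite ltnS leq_eqVlt => /orP[/eqP E|]; last exact: h.
  have -> : k = Ordinal iN by apply: val_inj.
  by move=> p; rewrite p e2 /= in pf; rewrite leqNgt pf.
rewrite n1 => H.
have [|[_ [h1 h2]]|[j [h1 h2 _ h3]]] := H.
- by move=> r rn; rewrite den_reg ?ss1.
- by left; split=> // j; apply: h2.
- by right; exists j; split=> // k; apply: h3.
Qed.

End Argmax.

Section LexKey.

Variables (m : nat) (T : Type) (f g : T -> nat).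
Hypothesis g_lt : forall x, g x < m.

(** Since [g] stays below [m], this number orders pairs lexicographically. The successors are there
    because the position tables hold positions plus one. *)
Definition lex_key (x : T) : nat := (f x).+1 * m + (g x).+1.

Lemma lex_key_lt1 x y : f x < f y -> lex_key x < lex_key y.
Proof.
move=> h; rewrite /lex_key.
have : (f x).+1 * m + m <= (f y).+1 * m by rewrite -mulSnr leq_mul2r ltnS h orbT.
by have := g_lt x; lia.
Qed.

Lemma lex_key_lt2 x y : f x = f y -> g x < g y -> lex_key x < lex_key y.
Proof. by rewrite /lex_key => ->; rewrite ltn_add2l. Qed.

Lemma lex_key_inj : injective g -> injective lex_key.
Proof.
move=> gi x y h; have [|] := ltnP (f x) (f y).
  by move/lex_key_lt1; rewrite h ltnn.
rewrite leq_eqVlt => /orP[/eqP E|/lex_key_lt1]; last by rewrite h ltnn.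
by apply: gi; move: h; rewrite /lex_key E; lia.
Qed.

End LexKey.

Lemma tree_minE (T : finType) (e : rel T) r L par (S : {set T}) p q m0 m :
  rooted_by e r L par ->
  (forall x y, e x y -> (x != r /\ par x = y) \/ (y != r /\ par y = x)) ->
  anc par m0 p ->
  (forall x, (x \in S) = anc par m0 x && (anc par x p || anc par x q)) ->
  tree_min e r S m <-> m = m0.
Proof.
move=> RB PE mp hS.
have m0S : m0 \in S by rewrite hS anc_refl mp.
split=> [[mS /(_ _ m0S) /(tree_leE RB PE) h]|->].
  by apply: (anc_antisym RB) => //; move: mS; rewrite hS => /andP[].
by split=> // x; rewrite hS => /andP[h _]; apply/(tree_leE RB PE).
Qed.

(* Registers: 0 and 1 the root edge, 2 the number of semi-guards, 6 the index i,
   10 the vertex s_i, 12 the code of t_i, 14 one plus the index of the semi-guard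
   to be replaced or 0. Array 13 holds the maximal ranks stored at the vertices
   of T_V. Arrays 20 to 25, for the side G_H: vertices in the order they were
   reached, one plus their positions, parents, ancestor matrix, min Gamma, ranks;
   30 to 35 likewise for G_V, and 40 to 42 for T_V rooted at vertex 0. *)
Definition edge_expr (eh ev : expr) : expr :=
  Mul (Get 33 (Add (Mul ev (Reg 4)) (Get 24 eh)))
      (Add (Get 33 (Add (Mul (Get 4 eh) (Reg 4)) ev))
           (Get 33 (Add (Mul (Get 5 eh) (Reg 4)) ev))).

Definition guardH : expr := Get 11 (Reg 7).
Definition guardV : expr := Get 12 (Reg 7).

Definition clear_prg : prg := PFor 7 4 (PPut 13 (Reg 7) (Cst 0)).

(** Products do not short-circuit: past the length of the list the other factors read leftover
    cells, and the first factor, being 0, cancels them. *)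
Definition collect_body : prg :=
  PIf (Mul (Lt (Reg 7) (Reg 2))
       (Mul (Mul (edge_expr (Get 34 guardV) (Get 24 guardH))
                 (edge_expr (Get 34 guardV) (Reg 10)))
            (Lt (Get 13 (Get 24 guardH)) (Get 25 guardH))))
     (PPut 13 (Get 24 guardH) (Get 25 guardH)) PSkip.

Definition collect_prg : prg := PFor 7 4 collect_body.

Definition push_body : prg :=
  PSeq (PSet 8 (Get 30 (Reg 7)))
  (PIf (Lt (Get 13 (Reg 8)) (Get 13 (Get 32 (Reg 8))))
     (PPut 13 (Reg 8) (Get 13 (Get 32 (Reg 8)))) PSkip).

Definition push_prg : prg := PFor 7 4 push_body.

Definition free_prg : prg :=
  argmax_prg 3 11 12
    (Mul (Mul (Lt (Get 13 (Get 4 (Reg 7))) (Get 25 (Reg 7)))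
              (Lt (Get 13 (Get 5 (Reg 7))) (Get 25 (Reg 7))))
         (edge_expr (Reg 7) (Reg 10)))
    (Get 25 (Reg 7)).

Definition guard_prg : prg :=
  argmax_prg 4 13 14
    (Mul (Lt (Reg 7) (Reg 2)) (edge_expr guardH (Reg 10))) (Get 25 guardH).

(** A replacement keeps the second component, so it overwrites one cell of array 11 in place; an
    addition uses the current length as the next free index. *)
Definition update_prg : prg :=
  PSeq (PPut 10 (Reg 6) (Reg 12))
  (PIf (Reg 12)
    (PIf (Reg 14)
      (PPut 11 (Defs.Sub (Reg 14) (Cst 1)) (Defs.Sub (Reg 12) (Cst 1)))
      (PSeq (PPut 11 (Reg 2) (Defs.Sub (Reg 12) (Cst 1)))
      (PSeq (PPut 12 (Reg 2) (Reg 10))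
            (PSet 2 (Add (Reg 2) (Cst 1))))))
    PSkip).

Definition step_prg : prg :=
  PSeq (PSet 10 (Get 9 (Reg 6)))
  (PSeq clear_prg (PSeq collect_prg (PSeq push_prg
  (PSeq free_prg (PSeq guard_prg update_prg))))).

Definition main_prg : prg := PSeq (PSet 2 (Cst 0)) (PFor 6 4 step_prg).

Lemma den_seq p q s : den (PSeq p q) s = den q (den p s). Proof. by []. Qed.

Lemma update_prg_arr10 s k : arr (den update_prg s) 10 k =
  if k == reg s 6 then reg s 12 else arr s 10 k.
Proof. by rewrite /update_prg /=; case: ifP => //; case: ifP. Qed.

Lemma den_if e p q s :
  den (PIf e p q) s = if value s e != 0 then den p s else den q s.
Proof. by []. Qed.

Lemma value_mul_neq0 s e1 e2 :
  (value s (Mul e1 e2) != 0) = (value s e1 != 0) && (value s e2 != 0).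
Proof. by rewrite /= muln_eq0 negb_or. Qed.

Lemma value_lt_neq0 s e1 e2 :
  (value s (Lt e1 e2) != 0) = (value s e1 < value s e2).
Proof. by rewrite /= eqb0 negbK. Qed.

(** * Algorithm 1 expressed through parent functions, path ends and minima *)

Section Algorithm.

Variables (a b : nat) (G : tpig 'I_a 'I_b).
Variables (rH : 'I_a) (LH : seq 'I_a) (parH : 'I_a -> 'I_a).
Variables (rV : 'I_b) (LV : seq 'I_b) (parV : 'I_b -> 'I_b).
Hypothesis RBH : rooted_by (treeH G) rH LH parH.
Hypothesis RBV : rooted_by (treeV G) rV LV parV.
Hypothesis PEH : forall x y, treeH G x y ->
  (x != rH /\ parH x = y) \/ (y != rH /\ parH y = x).
Hypothesis PEV : forall x y, treeV G x y ->
  (x != rV /\ parV x = y) \/ (y != rV /\ parV y = x).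
Variables (pH qH minH : 'I_a -> 'I_b) (pV qV minV : 'I_b -> 'I_a).
Hypothesis minHp : forall h, anc parV (minH h) (pH h).
Hypothesis minHq : forall h, anc parV (minH h) (qH h).
Hypothesis minVp : forall v, anc parH (minV v) (pV v).
Hypothesis edgeHE : forall h v,
  edge G h v = anc parV (minH h) v && (anc parV v (pH h) || anc parV v (qH h)).
Hypothesis edgeVE : forall h v,
  edge G h v = anc parH (minV v) h && (anc parH h (pV v) || anc parH h (qV v)).
Hypothesis root_edge : edge G rH rV.
Hypothesis root_leaf : leaf (treeV G) rV.

Definition keyH : 'I_a -> nat :=
  lex_key a (fun h => index (minH h) LV) (fun h => index h LH).
Definition keyV : 'I_b -> nat :=
  lex_key b (fun v => index (minV v) LH) (fun v => index v LV).

Lemma keyH_inj : injective keyH.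
Proof.
apply: lex_key_inj; first by move=> x; apply: (rooted_index_ltn RBH).
by move=> x y; apply: (index_inj_rooted RBH).
Qed.

Lemma keyV_inj : injective keyV.
Proof.
apply: lex_key_inj; first by move=> x; apply: (rooted_index_ltn RBV).
by move=> x y; apply: (index_inj_rooted RBV).
Qed.

Definition key_choices : choices 'I_a 'I_b :=
  Choices rH rV (fun x y => keyH x < keyH y) (fun x y => keyV x < keyV y).

Local Notation c := key_choices.

Lemma min_nbrHE h m : min_nbrH G c h m <-> m = minH h.
Proof.
apply: (tree_minE (q := qH h) _ RBV PEV (minHp h)) => x.
by rewrite inE edgeHE.
Qed.

Lemma min_nbrVE v m : min_nbrV G c v m <-> m = minV v.
Proof.
apply: (tree_minE (q := qV v) _ RBH PEH (minVp v)) => x.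
by rewrite inE edgeVE.
Qed.

Lemma key_linear_order n (key : 'I_n -> nat) :
  injective key -> linear_order (fun x y => key x < key y).
Proof.
move=> ki; split=> [x|y x z|x y xy]; [exact: ltnn|exact: ltn_trans|].
by rewrite -neq_ltn; apply: contra xy => /eqP /ki ->.
Qed.

(** A proper ancestor has a strictly smaller position. So strict comparability of the minima is
    decided by the first component of the key, and ties are resolved as in [<_b] by the second. *)
Lemma key_choices_valid : valid_choices G c.
Proof.
split=> //; [exact/key_linear_order/keyH_inj|exact/key_linear_order/keyV_inj| |].
- move=> x y [m1 [m2 [/min_nbrHE -> /min_nbrHE -> [[ne le]|[E [ne le]]]]]].
  + apply: lex_key_lt1 => [z|]; first exact: (rooted_index_ltn RBH).
    by apply: (anc_index_lt RBV); [apply/(tree_leE RBV PEV)|apply/eqP].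
  + apply: lex_key_lt2; first by rewrite E.
    by apply: (anc_index_lt RBH); [apply/(tree_leE RBH PEH)|apply/eqP].
- move=> x y [m1 [m2 [/min_nbrVE -> /min_nbrVE -> [[ne le]|[E [ne le]]]]]].
  + apply: lex_key_lt1 => [z|]; first exact: (rooted_index_ltn RBV).
    by apply: (anc_index_lt RBH); [apply/(tree_leE RBH PEH)|apply/eqP].
  + apply: lex_key_lt2; first by rewrite E.
    by apply: (anc_index_lt RBV); [apply/(tree_leE RBV PEV)|apply/eqP].
Qed.

Lemma lelHE x y : lelH c x y = (keyH x <= keyH y).
Proof. by rewrite /lelH leq_eqVlt (inj_eq keyH_inj). Qed.

Lemma lelVE x y : lelV c x y = (keyV x <= keyV y).
Proof. by rewrite /lelV leq_eqVlt (inj_eq keyV_inj). Qed.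

(** The part of the covering condition that does not involve [t]; it can be tested once per
    semi-guard before all [t] are examined. *)
Definition applicable (s : 'I_b) (g : 'I_a * 'I_b) : bool :=
  edge G (minV g.2) (minH g.1) && edge G (minV g.2) s.

Lemma coversP g t s : lelV c s g.2 -> edge G t s ->
  covers G c g t s <->
  [&& applicable s g, keyH t <= keyH g.1 & edge G t (minH g.1)].
Proof.
move=> sv ts; rewrite -lelHE; split.
  case=> [[mh [mv [/min_nbrHE -> /min_nbrVE -> sg]]]].
  case=> [_ [mh' [mv' [/min_nbrHE -> /min_nbrVE -> [h1 _]]]]].
  by rewrite !inE /applicable sg h1 => -> ->.
case/and3P=> /andP[h1 h2] h3 h4; split.
  by exists (minH g.1), (minV g.2); split=> //; [apply/min_nbrHE|apply/min_nbrVE].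
split=> //; exists (minH g.1), (minV g.2).
by split; [apply/min_nbrHE|apply/min_nbrVE| | |]; rewrite ?inE.
Qed.

(* If min Gamma(h) were strictly above min Gamma(t), then h <_b t. *)
Lemma edge_minH t h : keyH t <= keyH h ->
  edge G t (minH h) = anc parV (minH h) (pH t) || anc parV (minH h) (qH t).
Proof.
move=> th; rewrite edgeHE; case o: (_ || _); last by rewrite andbF.
rewrite andbT; suff : anc parV (minH t) (minH h) || anc parV (minH h) (minH t).
  case/orP=> // ht; have [->|ne] := eqVneq (minH h) (minH t); first exact: anc_refl.
  have lt : keyH h < keyH t.
    apply: lex_key_lt1 => [z|]; first exact: (rooted_index_ltn RBH).
    exact: anc_index_lt RBV _ _ ht ne.
  by rewrite leqNgt lt in th.
by case/orP: o => h'; [apply: (anc_total RBV (minHp t))|apply: (anc_total RBV (minHq t))].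
Qed.

Local Notation rkH := (key_rank keyH).

(** Expresses that the largest rank over a part of [W] is below [k]. Maxima are described only
    through such comparisons, so taking the larger of two cells becomes a conjunction. *)
Definition below_all (s : 'I_b) (W : seq ('I_a * 'I_b)) (U : pred 'I_b) (k : nat) :=
  all (fun g => applicable s g ==> U (minH g.1) ==> (rkH g.1 < k)) W.

Definition uncovered (s : 'I_b) (W : seq ('I_a * 'I_b)) (t : 'I_a) : bool :=
  [&& edge G t s, below_all s W (anc parV ^~ (pH t)) (rkH t) &
      below_all s W (anc parV ^~ (qH t)) (rkH t)].

Lemma uncoveredP s W t : (forall g, g \in W -> lelV c s g.2) -> edge G t s ->
  set_covers G c [set g in W] t s <-> ~~ uncovered s W t.
Proof.
move=> sW ts; rewrite /uncovered ts /= negb_and -!has_predC.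
have E g : g \in W -> covers G c g t s <->
    [&& applicable s g, rkH t <= rkH g.1 &
        anc parV (minH g.1) (pH t) || anc parV (minH g.1) (qH t)].
  move=> gW; rewrite (coversP (sW g gW) ts) (key_rank_leE keyH_inj).
  by case le: (keyH t <= _); rewrite ?andbF //= edge_minH.
split.
  case=> g; rewrite inE => gW /(E g gW) /and3P[ag le /orP[]] an; apply/orP; [left|right];
  by apply/hasP; exists g; rewrite //= ag an /= -leqNgt.
case/orP=> /hasP[g gW] /=; rewrite !negb_imply -leqNgt => /and3P[ag an le];
by exists g; rewrite ?inE //; apply/(E g gW); rewrite ag an le ?orbT.
Qed.

Lemma step_none s W : (forall g, g \in W -> lelV c s g.2) ->
  (forall t, ~~ uncovered s W t) -> step G c s [set g in W] None [set g in W].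
Proof.
move=> sW un; apply: StepNone => t; rewrite inE => ts.
exact/(uncoveredP sW ts).
Qed.

Lemma max_uncoveredP s W t : (forall g, g \in W -> lelV c s g.2) ->
  uncovered s W t -> (forall t', uncovered s W t' -> rkH t' <= rkH t) ->
  max_uncovered G c [set g in W] s t.
Proof.
move=> sW ut mt; have [ts _ _] := and3P ut.
split; first by rewrite inE.
  by move/(uncoveredP sW ts); rewrite ut.
move=> t'; rewrite inE => ts' nc; rewrite lelHE -(key_rank_leE keyH_inj); apply: mt.
by apply/negPn/negP => /(uncoveredP sW ts').
Qed.

Lemma step_add s W t : max_uncovered G c [set g in W] s t ->
  (forall g, g \in W -> ~~ edge G g.1 s) ->
  step G c s [set g in W] (Some t) [set g in rcons W (t, s)].
Proof.
move=> mt nW; have -> : [set g in rcons W (t, s)] = (t, s) |: [set g in W].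
  by apply/setP => g; rewrite !inE mem_rcons inE.
by apply: StepAdd => // h v; rewrite !inE => /nW.
Qed.

Lemma step_replace s W t (j : nat) g : max_uncovered G c [set g in W] s t ->
  uniq W -> j < size W -> edge G (nth g W j).1 s ->
  (forall g', g' \in W -> edge G g'.1 s -> rkH g'.1 <= rkH (nth g W j).1) ->
  step G c s [set g in W] (Some t)
    [set g' in set_nth g W j (t, (nth g W j).2)].
Proof.
move=> mt uW jW ej mj; set g' := nth g W j in ej mj *.
have -> : [set x in set_nth g W j (t, g'.2)] =
    (t, g'.2) |: ([set x in W] :\ (g'.1, g'.2)).
  rewrite set_nthE jW -surjective_pairing.
  (* As [W] has no repetitions, the replaced pair occurs only at position [j], so overwriting that
     entry really removes it from the set. *)
  move: uW; rewrite -[W in uniq W](cat_take_drop j) (drop_nth g jW) -/g'.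
  rewrite cat_uniq /= negb_or => /and4P[_ /andP[n1 _] n2 _].
  apply/setP => x; rewrite !inE -[in RHS](cat_take_drop j W) (drop_nth g jW) -/g'.
  rewrite !mem_cat !inE orbCA; case: eqP => //= _.
  by have [->|] := eqVneq x g' => //=; rewrite (negbTE n1) (negbTE n2).
apply: StepReplace => //.
- by rewrite inE -surjective_pairing mem_nth.
- by rewrite inE.
- move=> h v; rewrite !inE => hW he; rewrite lelHE -(key_rank_leE keyH_inj).
  exact: (mj (h, v)).
Qed.

Lemma steps_rcons ss s W ts t W1 W2 :
  steps G c ss W ts W1 -> step G c s W1 t W2 ->
  steps G c (rcons ss s) W (rcons ts t) W2.
Proof.
elim=> [W0|s0 ss0 W0 t0 W1' ts0 W2' st _ IH] h /=; last exact: StepsCons st (IH h).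
by apply: StepsCons h _; apply: StepsNil.
Qed.

(** * Memory invariants and the stages of one iteration *)

Record holds_ctx (st : state) : Prop := HoldsCtx {
  ctx_a : reg st 3 = a;
  ctx_b : reg st 4 = b;
  ctx_pH : forall h : 'I_a, arr st 4 h = pH h;
  ctx_qH : forall h : 'I_a, arr st 5 h = qH h;
  ctx_minH : forall h : 'I_a, arr st 24 h = minH h;
  ctx_rkH : forall h : 'I_a, arr st 25 h = rkH h;
  ctx_ord : forall v, arr st 30 (index v LV) = val v;
  ctx_par : forall v : 'I_b, arr st 32 v = parV v;
  ctx_anc : holds_anc 33 parV st;
  ctx_minV : forall v : 'I_b, arr st 34 v = minV v;
  ctx_sV : holds_seq st 9 (map val (key_sort keyV))
}.

Lemma holds_ctx_frame s st : holds_ctx s ->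
  reg st 3 = reg s 3 -> reg st 4 = reg s 4 ->
  (forall A k, A \notin [:: 10; 11; 12; 13] -> arr st A k = arr s A k) ->
  holds_ctx st.
Proof.
move=> [h1 h2 h3 h4 h5 h6 h7 h8 h9 h10 h11] e3 e4 F.
split; rewrite ?e3 ?e4 //; try by move=> x; rewrite F.
- by move=> x y; rewrite F.
- by move=> i hi; rewrite F // h11.
Qed.

(** The product acts as a conjunction and the sum as a disjunction. The sum can be 2, so only being
    nonzero carries meaning. *)
Lemma edge_exprE st eh ev (h : 'I_a) (v : 'I_b) : holds_ctx st ->
  value st eh = h -> value st ev = v ->
  (value st (edge_expr eh ev) != 0) = edge G h v.
Proof.
move=> C eh' ev'; rewrite /= eh' ev' (ctx_b C) (ctx_minH C) (ctx_pH C) (ctx_qH C).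
rewrite !(ctx_anc C) edgeHE.
by case: (anc _ _ _); case: (anc _ _ _); case: (anc _ _ _).
Qed.

Definition holds_guards (st : state) (W : seq ('I_a * 'I_b)) : Prop :=
  [/\ reg st 2 = size W, holds_seq st 11 [seq val g.1 | g <- W] &
      holds_seq st 12 [seq val g.2 | g <- W]].

Lemma holds_guards_nth st W g0 j : holds_guards st W -> j < size W ->
  arr st 11 j = (nth g0 W j).1 /\ arr st 12 j = (nth g0 W j).2.
Proof.
case=> _ h1 h2 jW; rewrite h1 ?h2 ?size_map //.
by rewrite !(nth_map g0).
Qed.

(** The restriction to positive [k] accounts for cells without any relevant semi-guard: they hold 0,
    which is not below 0, whereas [below_all] is vacuously true there. *)
Definition holds_max (st : state) (s : 'I_b) W (U : 'I_b -> pred 'I_b) : Prop :=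
  forall (x : 'I_b) k, 0 < k -> (arr st 13 x < k) = below_all s W (U x) k.

Lemma clear_prg_spec st : reg st 4 = b ->
  forall x : 'I_b, arr (den clear_prg st) 13 x = 0.
Proof.
move=> eb; pose I i st' := forall x : 'I_b, x < i -> arr st' 13 x = 0.
suff : I (reg st 4) (den clear_prg st) by rewrite eb => h x; apply: h.
apply: den_for_ind => // i st' _ ei _ _ Ii x; rewrite ltnS leq_eqVlt /= ei.
by case: eqP => //= _ /Ii.
Qed.

Lemma below_all_rcons s W g U k : below_all s (rcons W g) U k =
  (applicable s g ==> U (minH g.1) ==> (rkH g.1 < k)) && below_all s W U k.
Proof. by rewrite /below_all all_rcons. Qed.

Lemma collect_prg_spec st (s : 'I_b) W : holds_ctx st -> holds_guards st W ->
  size W <= b -> reg st 10 = s -> (forall x : 'I_b, arr st 13 x = 0) ->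
  holds_max (den collect_prg st) s W (fun x y => y == x).
Proof.
move=> C HW Wb e10 M0.
pose I i st' := holds_max st' s (take i W) (fun x y => y == x).
suff : I (reg st 4) (den collect_prg st).
  by rewrite (ctx_b C) /I take_oversize.
apply: den_for_ind; first by move=> x k k0; rewrite /= M0 k0 take0.
move=> i st' _ ei fr fa Ii.
have C' : holds_ctx st'.
  apply: (holds_ctx_frame C); rewrite ?fr // => A k.
  by rewrite !inE !negb_or => /and4P[_ _ _ h]; rewrite fa //= inE.
have HW' : holds_guards st' W.
  case: HW => w1 w2 w3; split; first by rewrite fr.
    by move=> k kW; rewrite fa // w2.
  by move=> k kW; rewrite fa // w3.
rewrite /I; have [iW|Wi] := ltnP i (size W); last first.
  rewrite take_oversize ?(leqW Wi) //; rewrite /I take_oversize // in Ii.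
  have -> : den collect_body st' = st'.
    rewrite /collect_body den_if value_mul_neq0 value_lt_neq0 /=.
    by rewrite ei; case: HW' => -> _ _; rewrite ltnNge Wi.
  exact: Ii.
have g0 : 'I_a * 'I_b by case: (W) iW => [//|g0 ? _]; exact: g0.
set g := nth g0 W i.
have [e1 e2] : arr st' 11 i = g.1 /\ arr st' 12 i = g.2 by apply: holds_guards_nth.
have eH : value st' guardH = g.1 by rewrite /= ei.
have eV : value st' guardV = g.2 by rewrite /= ei.
have e24 : value st' (Get 24 guardH) = minH g.1 by rewrite -(ctx_minH C') -eH.
have e34 : value st' (Get 34 guardV) = minV g.2 by rewrite -(ctx_minV C') -eV.
have e25 : value st' (Get 25 guardH) = rkH g.1 by rewrite -(ctx_rkH C') -eH.
have e10' : value st' (Reg 10) = s by rewrite /= fr.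
have -> : den collect_body st' =
    if applicable s g && (arr st' 13 (minH g.1) < rkH g.1)
    then set_arr st' 13 (minH g.1) (rkH g.1) else st'.
  rewrite /collect_body den_if 3!value_mul_neq0 !value_lt_neq0.
  rewrite (edge_exprE C' e34 e24) (edge_exprE C' e34 e10') e25.
  rewrite [value _ (Get 13 _)]/(arr st' 13 (value st' (Get 24 guardH))) e24.
  rewrite [X in X && _](_ : _ = true); last by rewrite /= ei; case: HW' => -> _ _.
  by rewrite [den _ _]/(set_arr st' 13 (value st' (Get 24 guardH))
                                       (value st' (Get 25 guardH))) e24 e25.
move=> x k k0; have {}Ii := Ii x k k0.
rewrite (take_nth g0) // below_all_rcons -/g -Ii.
case ag: (applicable s g) => //=.
have [E|ne] := eqVneq (minH g.1) x; last first.
  case: ifP => //= _; rewrite (_ : (val x == minH g.1) = false) //.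
  by apply/negP => /eqP /val_inj E; case/eqP: ne.
case: ifP => lt /=; last first.
  move/negbT: lt; rewrite -leqNgt E => le.
  by case xk: (arr st' 13 x < k); rewrite ?andbF // andbT (leq_ltn_trans le xk).
rewrite E eqxx; rewrite E in lt.
by case xk: (rkH g.1 < k) => //=; rewrite (ltn_trans lt xk).
Qed.

(** After [i] rounds the first [i] vertices in the order of visits hold the maximum over all
    ancestors, the others still their own. A parent precedes its child, so one comparison with its
    final value suffices; the root is compared with itself. *)
Lemma push_prg_spec st (s : 'I_b) W : holds_ctx st ->
  holds_max st s W (fun x y => y == x) ->
  holds_max (den push_prg st) s W (fun x y => anc parV y x).
Proof.
move=> C M0.
have sL := rooted_size RBV.
pose I i st' := forall (x : 'I_b) k, 0 < k -> (arr st' 13 x < k) =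
  below_all s W (fun y => if index x LV < i then anc parV y x else y == x) k.
suff H : I (reg st 4) (den push_prg st).
  move=> x k k0; have -> := H x k k0; rewrite (ctx_b C); apply: eq_all => g.
  by rewrite (rooted_index_ltn RBV).
apply: den_for_ind => // i st'; rewrite (ctx_b C) -[b in i < b]sL => iL ei fr fa Ii.
have C' : holds_ctx st'.
  apply: (holds_ctx_frame C); rewrite ?fr // => A k.
  by rewrite !inE !negb_or => /and4P[_ _ _ h]; rewrite fa //= inE.
pose x := nth rV LV i.
have ix : index x LV = i by rewrite index_uniq // (rooted_uniq RBV).
have e30 : arr st' 30 i = x by rewrite -ix (ctx_ord C').
have -> : den push_body st' =
    if arr st' 13 x < arr st' 13 (parV x)
    then set_arr (set_reg st' 8 x) 13 x (arr st' 13 (parV x)) else set_reg st' 8 x.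
  by rewrite /= ei e30 (ctx_par C') eqb0 negbK.
move=> y k k0.
have [->|ne] := eqVneq y x; last first.
  have -> : arr (set_reg (if arr st' 13 x < arr st' 13 (parV x)
      then set_arr (set_reg st' 8 x) 13 x (arr st' 13 (parV x))
      else set_reg st' 8 x) 7 i.+1) 13 y = arr st' 13 y.
    case: ifP => //= _; rewrite (_ : (val y == x) = false) //.
    by apply/negP => /eqP /val_inj E; case/eqP: ne.
  have iy : (index y LV == i) = false.
    by rewrite -ix; apply: contraNF ne => /eqP /(index_inj_rooted RBV) ->.
  by have -> := Ii y k k0; apply: eq_all => g; rewrite ltnS [index y LV <= i]leq_eqVlt iy.
have -> : (arr (set_reg (if arr st' 13 x < arr st' 13 (parV x)
      then set_arr (set_reg st' 8 x) 13 x (arr st' 13 (parV x))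
      else set_reg st' 8 x) 7 i.+1) 13 x < k) =
    (arr st' 13 x < k) && (arr st' 13 (parV x) < k).
  case: ifP => /= lt.
    by rewrite eqxx andbC; case h: (_ < k) => //=; rewrite (ltn_trans lt h).
  move/negbT: lt; rewrite -leqNgt => le.
  by case h: (_ < k) => //=; rewrite (leq_ltn_trans le h).
have -> := Ii x k k0; have -> := Ii (parV x) k k0; rewrite -all_predI; apply: eq_all => g /=.
rewrite ix ltnn ltnSn; case: (applicable s g) => //=.
have [xr|xr] := eqVneq x rV.
  rewrite xr (rooted_parr RBV) (anc_of_root RBV) if_same.
  by case: eqP => //= _; rewrite andbb.
rewrite -ix (par_index RBV xr) [anc _ _ x]ancE.
by case: eqP => //= _; case: (anc _ _ _) => //=; case: (rkH g.1 < k).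
Qed.

Lemma free_prg_spec st (s : 'I_b) W : holds_ctx st -> reg st 10 = s ->
  holds_max st s W (fun x y => anc parV y x) ->
  (reg (den free_prg st) 12 = 0 /\ forall t, ~~ uncovered s W t) \/
  exists t, [/\ uncovered s W t, reg (den free_prg st) 12 = t.+1 &
     forall t', uncovered s W t' -> rkH t' <= rkH t].
Proof.
move=> C e10 M.
apply: (fun p1 p2 => proj2 (argmax_prg_spec (P := uncovered s W) (V := rkH)
  (isT : uniq [:: 7; 3; 11; 12]) (ctx_a C) p1 p2)) => // st' t et fr fa.
have C' : holds_ctx st' by apply: (holds_ctx_frame C); rewrite ?fr.
have e10' : value st' (Reg 10) = s by rewrite /= fr.
rewrite 2!value_mul_neq0 !value_lt_neq0 (edge_exprE (eh := Reg 7) (h := t) C' et e10') andbC /=.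
rewrite et (ctx_pH C') (ctx_qH C') (ctx_rkH C') !fa; split=> //.
by rewrite !M.
Qed.

(** The search runs over [b] indices, so [size W <= b] is what guarantees that no semi-guard is
    missed. *)
Lemma guard_prg_spec st (s : 'I_b) W g0 : holds_ctx st -> reg st 10 = s ->
  holds_guards st W -> size W <= b ->
  (reg (den guard_prg st) 14 = 0 /\ forall g, g \in W -> ~~ edge G g.1 s) \/
  exists j, [/\ j < size W, edge G (nth g0 W j).1 s,
     reg (den guard_prg st) 14 = j.+1 &
     forall g, g \in W -> edge G g.1 s -> rkH g.1 <= rkH (nth g0 W j).1].
Proof.
move=> C e10 HW Wb.
pose P (j : 'I_b) := (j < size W) && edge G (nth g0 W j).1 s.
pose V (j : 'I_b) := rkH (nth g0 W j).1.
have [|st' j ej fr fa|_ [[h1 h2]|[j [h1 h2 h3]]]] := @argmax_prg_spec 4 13 14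
  (Mul (Lt (Reg 7) (Reg 2)) (edge_expr guardH (Reg 10))) (Get 25 guardH) isT st b
  P V (ctx_b C).
- by [].
- have C' : holds_ctx st' by apply: (holds_ctx_frame C); rewrite ?fr.
  have HW' : holds_guards st' W.
    by case: HW => w1 w2 w3; split=> [|k kW|k kW]; rewrite ?fr ?fa ?w2 ?w3.
  rewrite value_mul_neq0 value_lt_neq0 /P /V.
  have -> : (value st' (Reg 7) < value st' (Reg 2)) = (j < size W).
    by rewrite /= ej; case: HW' => ->.
  case jW: (j < size W); last by split.
  rewrite !andTb.
  have eH : value st' guardH = (nth g0 W j).1.
    by rewrite /= ej; case: (holds_guards_nth g0 HW' jW).
  have e10' : value st' (Reg 10) = s by rewrite /= fr.
  split; first exact: edge_exprE.
  by move=> _; rewrite -(ctx_rkH C') -eH.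
- left; split=> // g gW.
  have iW : index g W < size W by rewrite index_mem.
  have ib := leq_trans iW Wb.
  by have := h2 (Ordinal ib); rewrite /P /= iW nth_index.
- right; exists j; case/andP: h1 => jW ej; split=> // g gW eg.
  have iW : index g W < size W by rewrite index_mem.
  have ib := leq_trans iW Wb.
  by have := h3 (Ordinal ib); rewrite /P /V /= iW nth_index // => /(_ eg).
Qed.

(** The last clause feeds the induction: the list of second components is unchanged or gains the
    current vertex, so it remains a repetition-free list of treated vertices. *)
Lemma step_prg_spec st W i (s : 'I_b) : holds_ctx st -> i < b ->
  reg st 6 = i -> s = nth s (key_sort keyV) i ->
  holds_guards st W -> size W <= b -> uniq (map snd W) ->
  (forall g, g \in W -> lelV c s g.2) ->
  exists t W', [/\ step G c s [set g in W] t [set g in W'],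
    holds_guards (den step_prg st) W',
    arr (den step_prg st) 10 i = code_opt t,
    forall k, k != i -> arr (den step_prg st) 10 k = arr st 10 k &
    map snd W' = map snd W \/ map snd W' = rcons (map snd W) s].
Proof.
move=> C ib ei es HW Wb uW sW.
pose s1 := set_reg st 10 s.
have sz : size (key_sort keyV) = b by rewrite size_sort size_enum_ord.
have e9 : arr st 9 i = s.
  by rewrite (ctx_sV C) ?size_map ?sz // (nth_map s) ?sz // -es.
pose s2 := den clear_prg s1; pose s3 := den collect_prg s2.
pose s4 := den push_prg s3; pose s5 := den free_prg s4; pose s6 := den guard_prg s5.
have es1 : den (PSet 10 (Get 9 (Reg 6))) st = s1 by rewrite /= ei e9.
have -> : den step_prg st = den update_prg s6 by rewrite /step_prg 6!den_seq es1.
have Ck st' st'' : holds_ctx st' -> reg st'' 3 = reg st' 3 -> reg st'' 4 = reg st' 4 ->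
    (forall A k, A != 13 -> arr st'' A k = arr st' A k) -> holds_ctx st''.
  move=> C' e3 e4 F; apply: (holds_ctx_frame C') => // A k.
  by rewrite !inE !negb_or => /and4P[_ _ _ h]; apply: F.
have Wk st' st'' : holds_guards st' W -> reg st'' 2 = reg st' 2 ->
    (forall A k, A != 13 -> arr st'' A k = arr st' A k) -> holds_guards st'' W.
  by case=> w1 w2 w3 e2 F; split=> [|k kW|k kW]; rewrite ?e2 // F // ?w2 ?w3.
have N p A : written_arrs p = [:: 13] -> A != 13 -> A \notin written_arrs p by move=> ->; rewrite inE.
have C1 : holds_ctx s1 by apply: (Ck st).
have W1 : holds_guards s1 W by apply: (Wk st).
have C2 : holds_ctx s2.
  by apply: (Ck s1); rewrite ?den_reg // => A k h; rewrite den_arr ?N.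
have W2 : holds_guards s2 W.
  by apply: (Wk s1); rewrite ?den_reg // => A k h; rewrite den_arr ?N.
have C3 : holds_ctx s3.
  by apply: (Ck s2); rewrite ?den_reg // => A k h; rewrite den_arr ?N.
have W3 : holds_guards s3 W.
  by apply: (Wk s2); rewrite ?den_reg // => A k h; rewrite den_arr ?N.
have C4 : holds_ctx s4.
  by apply: (Ck s3); rewrite ?den_reg // => A k h; rewrite den_arr ?N.
have W4 : holds_guards s4 W.
  by apply: (Wk s3); rewrite ?den_reg // => A k h; rewrite den_arr ?N.
have C5 : holds_ctx s5.
  by apply: (Ck s4); rewrite ?den_reg // => A k h; rewrite den_arr.
have W5 : holds_guards s5 W.
  by apply: (Wk s4); rewrite ?den_reg // => A k h; rewrite den_arr.
have W6 : holds_guards s6 W.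
  by apply: (Wk s5); rewrite ?den_reg // => A k h; rewrite den_arr.
have r10 : reg s1 10 = s by [].
have r2 : reg s2 10 = s by rewrite den_reg.
have r4 : reg s4 10 = s by rewrite !den_reg.
have r5 : reg s5 10 = s by rewrite !den_reg.
have r6 : reg s6 10 = s by rewrite !den_reg.
have i6 : reg s6 6 = i by rewrite !den_reg.
have M2 := clear_prg_spec (ctx_b C1).
have M3 := collect_prg_spec C2 W2 Wb r2 M2.
have M4 := push_prg_spec C3 M3.
have e12 : reg s6 12 = reg s5 12 by rewrite den_reg.
have a10 k : arr s6 10 k = arr st 10 k by rewrite !den_arr.
have uW' : uniq W by apply: map_uniq uW.
have u10 k : arr (den update_prg s6) 10 k = if k == i then reg s6 12 else arr s6 10 k.
  by rewrite update_prg_arr10 i6.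
have FR := free_prg_spec C4 r4 M4.
have GR g0 := guard_prg_spec g0 C5 r5 W5 Wb.
rewrite -/s5 in FR; rewrite -/s6 in GR; clearbody s6 s5.
case: FR => [[t0 un]|[t [ut et mt]]].
  exists None, W; split; [exact: step_none| | | |by left].
  - by case: W6 => w1 w2 w3; rewrite /= e12 t0.
  - by rewrite u10 eqxx e12 t0.
  - by move=> k ki; rewrite u10 (negbTE ki) a10.
have mu := max_uncoveredP sW ut mt.
have e12t : reg s6 12 = t.+1 by rewrite e12.
case: (GR (t, s)) => [[g0 nW]|[j [jW ej eg mj]]].
  exists (Some t), (rcons W (t, s)); split.
  - exact: step_add.
  - case: W6 => w1 w2 w3; rewrite /holds_guards /= e12t /= g0 /= w1 subn1 /= r6.
    split; rewrite ?map_rcons; first by rewrite size_rcons addn1.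
      move=> k; rewrite size_rcons size_map ltnS nth_rcons size_map leq_eqVlt /=.
      case: eqP => [-> _|_ /= kW]; first by rewrite ltnn.
      by rewrite kW w2 ?size_map.
    move=> k; rewrite size_rcons size_map ltnS nth_rcons size_map leq_eqVlt /=.
    case: eqP => [-> _|_ /= kW]; first by rewrite ltnn.
    by rewrite kW w3 ?size_map.
  - by rewrite u10 eqxx e12t.
  - by move=> k ki; rewrite u10 (negbTE ki) a10.
  - by right; rewrite map_rcons.
set g := nth _ W j in ej mj.
exists (Some t), (set_nth (t, s) W j (t, g.2)); split.
- exact: step_replace.
- have sj : size (set_nth (t, s) W j (t, g.2)) = size W.
    by rewrite size_set_nth; apply/maxn_idPr.
  case: W6 => w1 w2 w3; rewrite /holds_guards /= e12t /= eg /= w1 !subn1 /=.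
  split; rewrite ?sj //.
    move=> k; rewrite size_map sj => kW.
    rewrite (nth_map (t, s)) ?sj // nth_set_nth /=.
    by case: eqP => //= _; rewrite w2 ?size_map // (nth_map (t, s)).
  move=> k; rewrite size_map sj => kW.
  rewrite (nth_map (t, s)) ?sj // nth_set_nth /=.
  rewrite w3 ?size_map // (nth_map (t, s)) //.
  by case: eqP => [->|].
- by rewrite u10 eqxx e12t.
- by move=> k ki; rewrite u10 (negbTE ki) a10.
- left; rewrite set_nthE jW map_cat /= -[in RHS](cat_take_drop j W) map_cat.
  by rewrite (drop_nth (t, s) jW).
Qed.

Lemma main_prg_spec st : holds_ctx st ->
  exists ts W, [/\ run G c (key_sort keyV) ts [set g in W] /\ uniq W,
    reg (den main_prg st) 2 = size W,
    holds_seq (den main_prg st) 10 (map (@code_opt a) ts) &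
    holds_seq (den main_prg st) 11 [seq val g.1 | g <- W] /\
    holds_seq (den main_prg st) 12 [seq val g.2 | g <- W]].
Proof.
move=> C; set sV := key_sort keyV.
have [pe srt] := key_sort_decreasing keyV_inj.
have sz : size sV = b by rewrite size_sort size_enum_ord.
pose I i st' := exists ts W, [/\ steps G c (take i sV) set0 ts [set g in W],
  size ts = i /\ holds_seq st' 10 (map (@code_opt a) ts),
  holds_guards st' W, uniq (map snd W) & {subset map snd W <= take i sV}].
pose st1 := set_reg st 2 0; have e4 : reg st1 4 = b := ctx_b C.
have : I (reg st1 4) (den main_prg st).
  apply: (@den_for_ind 6 4 step_prg st1).
    exists [::], [::]; split=> //.
    rewrite take0 (_ : [set g in [::]] = set0); first exact: StepsNil.
    by apply/setP => g; rewrite !inE.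
  move=> i st'; rewrite e4 => ib ei fr fa [ts [W [hs [sts hts] HW uW sub]]].
  have C' : holds_ctx st'.
    apply: (holds_ctx_frame C); rewrite ?fr // => A k h.
    rewrite fa //; apply: contra h; rewrite /= !inE.
    by case: (A == 10); case: (A == 11); case: (A == 12); case: (A == 13).
  pose s : 'I_b := nth (Ordinal ib) sV i.
  have es : s = nth s sV i by apply: set_nth_default; rewrite sz.
  have tk : take i.+1 sV = rcons (take i sV) s by rewrite (take_nth (Ordinal ib)) // sz.
  have uV : uniq sV by rewrite sort_uniq enum_uniq.
  (* Second components lie in the treated prefix of a decreasing list. This supplies the hypothesis
     on second components under which covering was characterised. *)
  have sWlt g : g \in W -> keyV s < keyV g.2.
    move=> gW; have /sub : g.2 \in map snd W by apply: map_f.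
    have tr : transitive (fun x y : 'I_b => keyV y < keyV x).
      by move=> u v w h1 h2; apply: ltn_trans h2 h1.
    move: srt; rewrite sorted_pairwise // -[X in pairwise _ X](cat_take_drop i.+1).
    rewrite -/sV tk pairwise_cat pairwise_rcons => /and3P[_ /andP[h _] _] gs.
    by move/allP: h => /(_ _ gs).
  have sW g : g \in W -> lelV c s g.2 by move=> /sWlt h; rewrite lelVE ltnW.
  (* Distinct second components embed [W] into the [b] vertices of $G_V$. *)
  have Wb : size W <= b.
    rewrite -(size_map snd) -[b in _ <= b]card_ord -(card_uniqP uW).
    exact: max_card.
  have [t [W' [stp HW' e10 k10 W'2]]] := step_prg_spec C' ib ei es HW Wb uW sW.
  have sn : s \notin map snd W by apply/negP => /mapP[g /sWlt h E]; rewrite -E ltnn in h.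
  move: (den step_prg st') HW' e10 k10 => st2 HW' e10 k10.
  exists (rcons ts t), W'; split.
  - by rewrite tk; apply: steps_rcons hs stp.
  - split; first by rewrite size_rcons sts.
    move=> k; rewrite map_rcons size_rcons size_map sts ltnS nth_rcons size_map sts /=.
    rewrite leq_eqVlt; case: (eqVneq k i) => [-> _|ki /= kts]; first by rewrite ltnn e10.
    by rewrite k10 // kts hts ?size_map ?sts.
  - by case: HW' => w1 w2 w3; split.
  - by case: W'2 => ->; rewrite // rcons_uniq sn.
  - rewrite tk => v; rewrite mem_rcons inE.
    case: W'2 => ->; first by move=> /sub ->; rewrite orbT.
    by rewrite mem_rcons inE => /orP[-> //|/sub ->]; rewrite orbT.
rewrite e4 => -[ts [W [hs [_ hts] [w1 w2 w3] uW _]]].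
exists ts, W; split=> //; split; last exact: map_uniq uW.
split; [exact: key_choices_valid|by split|].
by move: hs; rewrite take_oversize // sz.
Qed.

End Algorithm.

(** * The whole emulation *)

Lemma nth_edges1 n (e : rel 'I_n) (l : (n.-1).-tuple ('I_n * 'I_n)) :
  lists_edges e l -> forall j, j < n -> exists x y : 'I_n,
  [/\ nth 0 [seq val p.1 | p <- l] j = x, nth 0 [seq val p.2 | p <- l] j = y &
      x = y \/ e x y].
Proof.
move=> le j jn; have n0 : 0 < n by apply: leq_trans jn.
pose o := Ordinal n0.
have [jl|lj] := ltnP j (size l); last first.
  (* The surplus round of a sweep: past the end of the edge list both arrays read 0, giving the
     harmless pair with equal ends. *)
  by exists o, o; rewrite !nth_default ?size_map //; split=> //; left.
exists (nth (o, o) l j).1, (nth (o, o) l j).2.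
rewrite !(nth_map (o, o)) //; split=> //; right.
by rewrite le -surjective_pairing mem_nth.
Qed.

Lemma nth_edges2 n (e : rel 'I_n) (l : (n.-1).-tuple ('I_n * 'I_n)) :
  lists_edges e l -> forall x y, e x y -> exists2 j, j < n &
  (nth 0 [seq val p.1 | p <- l] j = x /\ nth 0 [seq val p.2 | p <- l] j = y) \/
  (nth 0 [seq val p.1 | p <- l] j = y /\ nth 0 [seq val p.2 | p <- l] j = x).
Proof.
move=> le x y; rewrite le => h.
have K u v : (u, v) \in (l : seq _) -> exists2 j, j < n &
    nth 0 [seq val p.1 | p <- l] j = u /\ nth 0 [seq val p.2 | p <- l] j = v.
  move=> uv; have il : index (u, v) l < size l by rewrite index_mem.
  exists (index (u, v) l).
    by move: il; rewrite size_tuple => /leq_trans; apply; apply: leq_pred.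
  by rewrite !(nth_map (u, v)) // nth_index.
by case/orP: h => /K[j jn hj]; exists j => //; [left|right].
Qed.

Lemma nth_map_enum n (f : 'I_n -> nat) (i : 'I_n) :
  nth 0 [seq f x | x <- enum 'I_n] i = f i.
Proof. by rewrite (nth_map i) ?size_enum_ord // nth_ord_enum. Qed.

(** Children come after their parent in the order of visits, so the last vertex has none and its
    parent is the only possible neighbour. *)
Lemma leaf_last (T : finType) (e : rel T) r L par x : rooted_by e r L par ->
  (forall x y, e x y -> (x != r /\ par x = y) \/ (y != r /\ par y = x)) ->
  (forall y, index y L <= index x L) -> leaf e x.
Proof.
move=> RB PE mx; rewrite /leaf -(cards1 (par x)); apply: subset_leq_card.
apply/subsetP => y; rewrite !inE => /PE[[_ ->] //|[yr yx]].
by have := par_index RB yr; rewrite yx ltnNge mx.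
Qed.

(** The apex of the path is a common ancestor of the ends and all other common ancestors lie above
    it, so it is the one with the largest position. *)
Lemma lca_ofE n (e : rel 'I_n) r L par m (p q : 'I_m -> 'I_n) (S : 'I_m -> {set 'I_n})
    i z :
  rooted_by e r L par ->
  (forall x y, e x y -> (x != r /\ par x = y) \/ (y != r /\ par y = x)) ->
  path_with_ends e (p i) (q i) (S i) -> lca_of L par p q i z ->
  forall x, (x \in S i) = anc par z x && (anc par x (p i) || anc par x (q i)).
Proof.
move=> RB PE /(path_anc RB PE)[m0 [m0p m0q lm Sm]] [zp zq lz].
suff -> : z = m0 by [].
have zm := lm z zp zq.
apply: (index_inj_rooted RB); apply/eqP.
by rewrite eqn_leq (anc_index RB zm) lz.
Qed.

Definition rootV0_prg : prg := root_prg 2 3 40 41 42 4 1.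
Definition rootH_prg : prg := root_prg 0 1 20 21 22 3 0.
Definition rootV_prg : prg := root_prg 2 3 30 31 32 4 1.
Definition ancH_prg : prg := anc_prg 20 22 23 3.
Definition ancV_prg : prg := anc_prg 30 32 33 4.
Definition lcaH_prg : prg := lca_prg 30 33 4 5 24 4 3.
Definition lcaV_prg : prg := lca_prg 20 23 6 7 34 3 4.
Definition rankH_prg : prg := rank_prg 24 31 21 25 8 3.
Definition rankV_prg : prg := rank_prg 34 21 31 35 9 4.
Definition leaf_prg : prg := PSet 1 (Get 40 (Defs.Sub (Reg 4) (Cst 1))).
Definition root_edge_prg : prg := PSet 0 (Get 6 (Reg 1)).

Definition emulation_prg : prg :=
  PSeq (PSet 1 (Cst 0)) (PSeq rootV0_prg (PSeq leaf_prg (PSeq root_edge_prg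
  (PSeq rootH_prg (PSeq rootV_prg (PSeq ancH_prg (PSeq ancV_prg
  (PSeq lcaH_prg (PSeq lcaV_prg (PSeq rankH_prg (PSeq rankV_prg
  main_prg))))))))))).

Lemma emulation_spec a b (G : tpig 'I_a 'I_b) (R : sparse_rep a b) t0 :
  represents R G -> reg t0 3 = a -> reg t0 4 = b ->
  (forall A i, arr t0 A i = nth 0 (nth [::] (input_arrays R) A) i) ->
  output_run G (den emulation_prg t0).
Proof.
move=> [leH leV pwH pwV] a3 b4 inp.
have [/[!card_ord] a0 [symH _] conH _] := treeHP G.
have [/[!card_ord] b0 [symV _] conV _] := treeVP G.
have szH : size (edgesH R) = #|'I_a|.-1 by rewrite size_tuple card_ord.
have szV : size (edgesV R) = #|'I_b|.-1 by rewrite size_tuple card_ord.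
pose pH h := (endsH R h).1; pose qH h := (endsH R h).2.
pose pV v := (endsV R v).1; pose qV v := (endsV R v).2.
have st p s : exists2 s', s' = den p s & (forall r, r \notin written_regs p -> reg s' r = reg s r)
    /\ (forall A i, A \notin written_arrs p -> arr s' A i = arr s A i).
  by exists (den p s) => //; split=> [r|A i]; [apply: den_reg|apply: den_arr].
rewrite /emulation_prg 12!den_seq.
have [t1 E1 [R1 A1]] := st (PSet 1 (Cst 0)) t0; rewrite -E1.
have [t2 E2 [R2 A2]] := st rootV0_prg t1; rewrite -E2.
have [t3 E3 [R3 A3]] := st leaf_prg t2; rewrite -E3.
have [t4 E4 [R4 A4]] := st root_edge_prg t3; rewrite -E4.
have [t5 E5 [R5 A5]] := st rootH_prg t4; rewrite -E5.
have [t6 E6 [R6 A6]] := st rootV_prg t5; rewrite -E6.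
have [t7 E7 [R7 A7]] := st ancH_prg t6; rewrite -E7.
have [t8 E8 [R8 A8]] := st ancV_prg t7; rewrite -E8.
have [t9 E9 [R9 A9]] := st lcaH_prg t8; rewrite -E9.
have [t10 E10 [R10 A10]] := st lcaV_prg t9; rewrite -E10.
have [t11 E11 [R11 A11]] := st rankH_prg t10; rewrite -E11.
have [t12 E12 [R12 A12]] := st rankV_prg t11; rewrite -E12.
have [t13 E13 [R13 A13]] := st main_prg t12; rewrite -E13.
have eV1 t : (forall A j, A \in [:: 2; 3] -> arr t A j = arr t0 A j) ->
    forall j, j < b -> exists x y : 'I_b,
    [/\ arr t 2 j = x, arr t 3 j = y & x = y \/ treeV G x y].
  by move=> F j jb; rewrite !F // !inp; apply: nth_edges1 leV _ jb.
have eV2 t : (forall A j, A \in [:: 2; 3] -> arr t A j = arr t0 A j) ->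
    forall x y, treeV G x y -> exists2 j, j < b &
    (arr t 2 j = x /\ arr t 3 j = y) \/ (arr t 2 j = y /\ arr t 3 j = x).
  move=> F x y /(nth_edges2 leV)[j jb h]; exists j => //.
  by rewrite !F // !inp.
have b1 : reg t1 4 = b by rewrite R1.
have b5 : reg t5 4 = b by rewrite R5 // R4 // R3 // R2.
have a4 : reg t4 3 = a by rewrite R4 // R3 // R2 // R1.
have F1 A i : arr t1 A i = arr t0 A i by rewrite A1.
have F4 A i : A \notin [:: 40; 41; 42] -> arr t4 A i = arr t0 A i.
  move=> h; rewrite A4 // A3 // A2 // /rootV0_prg; apply: contra h.
  by rewrite /= !inE; case: (A == 40); case: (A == 41); case: (A == 42).
pose o : 'I_b := Ordinal b0.
have [L0 [par0 [RB0 O0 _ _]]] : exists L par, [/\ rooted_by (treeV G) o L par,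
    forall x, arr t2 40 (index x L) = val x,
    forall x : 'I_b, arr t2 41 x = (index x L).+1 &
    forall x : 'I_b, arr t2 42 x = val (par x)].
  rewrite E2; apply: root_prg_spec => //.
  - by rewrite E1.
  - by move=> x; rewrite F1 inp nth_nil.
  - exact: eV1.
  - exact: eV2.
have PE0 := parent_edges RB0 leV szV.
pose rV := nth o L0 b.-1.
have sL0 := rooted_size RB0.
have irV : index rV L0 = b.-1.
  by rewrite index_uniq ?(rooted_uniq RB0) // sL0 prednK.
have leafV : leaf (treeV G) rV.
  apply: (leaf_last RB0 PE0) => y; rewrite irV.
  by rewrite -ltnS prednK //; exact: rooted_index_ltn RB0 y.
have r3 : reg t3 1 = rV.
  by rewrite E3 /= subn1 R2 // b1 -irV O0.
have r4 : reg t4 1 = rV by rewrite R4.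
pose rH := pV rV.
have rt4 : reg t4 0 = rH.
  rewrite E4 /= r3 -(A4 6) // F4 // inp.
  exact: (nth_map_enum (fun v => val (endsV R v).1)).
have root_edge : edge G rH rV.
  have [p [_ _ _ hS]] := pwV rV.
  by have := hS rH; rewrite inE mem_head.
have [LH [parH [RBH OH5 PH5 QH5]]] : exists L par, [/\ rooted_by (treeH G) rH L par,
    forall x, arr t5 20 (index x L) = val x,
    forall x : 'I_a, arr t5 21 x = (index x L).+1 &
    forall x : 'I_a, arr t5 22 x = val (par x)].
  rewrite E5; apply: root_prg_spec => //.
  - by move=> x; rewrite F4 // inp nth_nil.
  - by move=> j ja; rewrite !F4 // !inp; apply: nth_edges1 leH _ ja.
  - move=> x y /(nth_edges2 leH)[j ja h]; exists j => //.
    by rewrite !F4 // !inp.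
have F5 A i : A \notin [:: 40; 41; 42; 20; 21; 22] -> arr t5 A i = arr t0 A i.
  move=> h; rewrite A5 ?F4 //; apply: contra h; rewrite /= !inE.
    by case: (A == 40); case: (A == 41); case: (A == 42).
  by case: (A == 20); case: (A == 21); case: (A == 22); rewrite ?orbT.
have [LV [parV [RBV OV6 PV6 QV6]]] : exists L par, [/\ rooted_by (treeV G) rV L par,
    forall x, arr t6 30 (index x L) = val x,
    forall x : 'I_b, arr t6 31 x = (index x L).+1 &
    forall x : 'I_b, arr t6 32 x = val (par x)].
  rewrite E6; apply: root_prg_spec => //.
  - by rewrite R5.
  - by move=> x; rewrite F5 // inp nth_nil.
  - by apply: eV1 => A j; rewrite !inE => /orP[]/eqP ->; rewrite F5.
  - by apply: eV2 => A j; rewrite !inE => /orP[]/eqP ->; rewrite F5.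
have PEH := parent_edges RBH leH szH; have PEV := parent_edges RBV leV szV.
have a6 : reg t6 3 = a by rewrite R6 // R5.
have b7 : reg t7 4 = b by rewrite R7 // R6.
have ancH7 : holds_anc 23 parH t7.
  rewrite E7; apply: (anc_prg_spec _ _ RBH) => // x.
    by rewrite A6 // OH5.
  by rewrite A6 // QH5.
have ancV8 : holds_anc 33 parV t8.
  rewrite E8; apply: (anc_prg_spec _ _ RBV) => // x.
    by rewrite A7 // OV6.
  by rewrite A7 // QV6.
have F8 A i : A < 8 -> arr t8 A i = arr t0 A i.
  by do 8 (case: A => [|A]; first by rewrite A8 // A7 // A6 // F5).
have a8 : reg t8 3 = a by rewrite R8 // R7.
have b8 : reg t8 4 = b by rewrite R8.
have iends : [/\ forall h : 'I_a, arr t8 4 h = pH h, forall h : 'I_a, arr t8 5 h = qH h,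
    forall v : 'I_b, arr t8 6 v = pV v & forall v : 'I_b, arr t8 7 v = qV v].
  split=> x; rewrite F8 // inp.
  - exact: (nth_map_enum (fun v => val (endsH R v).1)).
  - exact: (nth_map_enum (fun v => val (endsH R v).2)).
  - exact: (nth_map_enum (fun v => val (endsV R v).1)).
  - exact: (nth_map_enum (fun v => val (endsV R v).2)).
have [ip iq jp jq] := iends.
have /fin_all_exists2[minH lcaH eH] : forall h : 'I_a, exists2 z,
    lca_of LV parV pH qH h z & arr t9 24 h = val z.
  rewrite E9; apply: (lca_prg_spec _ _ RBV) => // x.
  by rewrite A8 // A7 // OV6.
have /fin_all_exists2[minV lcaV eV] : forall v : 'I_b, exists2 z,
    lca_of LH parH pV qV v z & arr t10 34 v = val z.
  rewrite E10; apply: (lca_prg_spec _ _ RBH) => //.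
  - by rewrite R9.
  - by rewrite R9.
  - by move=> x; rewrite A9 // A8 // A7 // A6 // OH5.
  - by move=> x y; rewrite A9 // A8 // ancH7.
  - by move=> x; rewrite A9.
  - by move=> x; rewrite A9.
have kHi : injective (keyH LH LV minH) by move=> ? ?; apply: (@keyH_inj a b G rH LH parH LV RBH minH).
have kVi : injective (keyV LH LV minV) by move=> ? ?; apply: (@keyV_inj a b G LH rV LV parV RBV minV).
have [rkH sH] : (forall x : 'I_a, arr t11 25 x = key_rank (keyH LH LV minH) x) /\
    holds_seq t11 8 (map val (key_sort (keyH LH LV minH))).
  rewrite E11; apply: rank_prg_spec => //; first by rewrite R10 // R9.
  move=> x; rewrite (A10 24) // eH !A10 // !A9 // !A8 // !A7 // PV6 A6 // PH5.
  by [].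
have [_ sV] : (forall x : 'I_b, arr t12 35 x = key_rank (keyV LH LV minV) x) /\
    holds_seq t12 9 (map val (key_sort (keyV LH LV minV))).
  rewrite E12; apply: rank_prg_spec => //; first by rewrite R11 // R10 // R9.
  move=> x; rewrite (A11 34) // eV !A11 // !A10 // !A9 // !A8 // !A7 // PV6 A6 // PH5.
  by [].
have edgeHE h v : edge G h v =
    anc parV (minH h) v && (anc parV v (pH h) || anc parV v (qH h)).
  have := lca_ofE (S := nbrH G) RBV PEV (pwH h) (lcaH h) v.
  by rewrite inE.
have edgeVE h v : edge G h v =
    anc parH (minV v) h && (anc parH h (pV v) || anc parH h (qV v)).
  have := lca_ofE (S := nbrV G) RBH PEH (pwV v) (lcaV v) h.
  by rewrite inE.
have ctx : holds_ctx LH LV parV pH qH minH minV t12.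
  split.
  - by rewrite R12 // R11 // R10 // R9.
  - by rewrite R12 // R11 // R10 // R9.
  - by move=> h; rewrite A12 // A11 // A10 // A9.
  - by move=> h; rewrite A12 // A11 // A10 // A9.
  - by move=> h; rewrite A12 // A11 // A10.
  - by move=> h; rewrite A12.
  - by move=> x; rewrite A12 // A11 // A10 // A9 // A8 // A7.
  - by move=> x; rewrite A12 // A11 // A10 // A9 // A8 // A7.
  - by move=> x y; rewrite A12 // A11 // A10 // A9.
  - by move=> v; rewrite A12 // A11.
  - exact: sV.
have mHp h : anc parV (minH h) (pH h) by case: (lcaH h).
have mHq h : anc parV (minH h) (qH h) by case: (lcaH h).
have mVp v : anc parH (minV v) (pV v) by case: (lcaV v).
have [ts [W [hrun h2 h10 h11]]] := main_prg_spec RBH RBV PEH PEV mHp mHq mVp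
  edgeHE edgeVE root_edge leafV ctx.
exists (key_choices rH LH rV LV minH minV), (key_sort (keyH LH LV minH)),
  (key_sort (keyV LH LV minV)), ts, W.
rewrite -E13 in h2 h10 h11; split=> //.
- exact: key_sort_decreasing.
- split=> //.
  + by rewrite R13 // R12 // R11 // R10 // R9 // R8 // R7 // R6 // R5.
  + by rewrite R13 // R12 // R11 // R10 // R9 // R8 // R7 // R6 // R5.
- split=> // i hi.
  + by rewrite A13 // A12 // sH.
  + by rewrite A13 // sV.
Qed.

Theorem theorem10 :
  exists (P : cmd) (w C : nat),
    forall (a b : nat) (G : tpig 'I_a 'I_b) (R : sparse_rep a b),
      represents R G ->
      let n := a + b in
      exists (t : nat) (s : state),
        [/\ exec (n ^ w) P (input_state R) t s,
            t <= C * n ^ 2 &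
            output_run G s].
Proof.
(* Admissibility and loop depth at most 2 are decided by computation on the closed program; the time
   bound needs nothing else about it. *)
have [|//|w [C [w0 ex]]] := @exec_compile emulation_prg; first by vm_compute.
(* The sizes move from registers 0 and 1, which will receive the root edge, to the loop bounds 3 and
   4. The two copies stand outside the structured program, since admissible programs may not write
   these bounds; each costs 2, whence [C + 4]. *)
exists (Seq (SetReg 3 (Reg 0)) (Seq (SetReg 4 (Reg 1)) (compile emulation_prg))), w, (C + 4).
move=> a b G R rep n.
have [/[!card_ord] a0 _ _ _] := treeHP G.
have [/[!card_ord] b0 _ _ _] := treeVP G.
(* Both trees are nonempty, so [n] is at least 2, as needed for powers of [n] to exceed
   constants. *)
have n1 : 1 < n by rewrite /n; lia.
have nw : n <= n ^ w by rewrite -{1}(expn1 n) leq_pexp2l // ltnW.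
pose t0 := set_reg (set_reg (input_state R) 3 a) 4 b.
have ct0 : cells_le t0 n.
  split=> [r|A i] /=.
    do 2 (case: ifP => _; first by rewrite /n; lia).
    by case: r => [|[|r]] /=; rewrite /n ?nth_nil; lia.
  have H m (T : Type) (f : T -> 'I_m) (l : seq T) : m <= n ->
      nth 0 [seq val (f x) | x <- l] i <= n.
    move=> mn; have [il|li] := ltnP i (size l); last by rewrite nth_default ?size_map.
    case: l il => // x l il.
    by rewrite (nth_map x) //; apply: leq_trans mn; apply: ltnW; apply: ltn_ord.
  have [an bn] : a <= n /\ b <= n by rewrite /n; lia.
  do 8 (case: A => [|A]; first by apply: H).
  by rewrite /= !nth_nil.
have [t et tC] := ex n t0 n1 ct0 (leq_addr _ _) (leq_addl _ _).
exists (2 + (2 + t)), (den emulation_prg t0); split.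
- apply: ExSeq; first by apply: ExSetReg; rewrite /= /word (_ : a < n ^ w) //; lia.
  apply: ExSeq et; apply: ExSetReg; rewrite /= /word (_ : b < n ^ w) //; lia.
- rewrite mulnDl; have : 0 < n ^ 2 by rewrite expn_gt0 ltnW.
  by lia.
- exact: emulation_spec rep _ _ _.
Qed.
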